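(* Let $\Omega\subset\mathbb{R}^d$ be a bounded Lipschitz domain, $\Gamma\subset\partial\Omega$ a relatively open $C^{1,1}$ patch with outer unit normal $\nu$, and let $p$ and $J$ be of class $C^1$ in space and time up to $\Gamma$ on a time interval, satisfying there the continuity equation $\partial_tp+\nabla\cdot J=0$ in $\Omega$ near $\Gamma$, with $J\cdot\nu=0$ on $\Gamma$. Suppose $p$ vanishes on $\Gamma$ nondegenerately: $p|_\Gamma\equiv0$ and $p(x,t)\ge c\operatorname{dist}(x,\Gamma)$ with $c>0$ for $x\in\Omega$ near $\Gamma$. Let $v:=J/p$, $x_0\in\Gamma$, $\nu_0:=\nu(x_0)$, and fix $t_0$ in the time interval. If $$v(x,t_0)\cdot\nu_0\ \not\longrightarrow\ 0\qquad\text{as }\Omega\ni x\to x_0$$ (the approach being unrestricted), then $v(\cdot,t_0)\notin L^1$ on any spatial collar of $x_0$.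
   Context: A spatial collar of $x_0$ is a set of the form $\Omega\cap N$ with $N$ an open neighbourhood of $x_0$ in $\mathbb{R}^d$. ''$C^1$ in space and time up to $\Gamma$'' means that the function and its first derivatives in $(x,t)$ extend continuously to $((\Omega\cap U)\cup\Gamma)\times I$, for some open $U\supset\Gamma$ and the given time interval $I$. *)

(* Defs.v *)
From HB Require Import structures.
From mathcomp Require Import all_boot all_order all_algebra.
From mathcomp Require Import all_classical all_reals all_analysis.

Set Implicit Arguments.
Unset Strict Implicit.
Unset Printing Implicit Defensive.
Import Order.TTheory GRing.Theory Num.Theory.
Import numFieldNormedType.Exports.
Local Open Scope classical_set_scope.
Local Open Scope ring_scope.

(* The library norm on ['rV[R]_d] is the sup norm, so the Euclidean one is
   defined here; both induce the topology used below. *)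
Definition edot (R : realType) (d : nat) (u v : 'rV[R]_d) : R :=
  \sum_i u 0 i * v 0 i.

Definition enorm (R : realType) (d : nat) (u : 'rV[R]_d) : R :=
  Num.sqrt (edot u u).

Definition dist_to (R : realType) (d : nat) (x : 'rV[R]_d) (A : set 'rV[R]_d)
    : R :=
  inf [set enorm (x - y) | y in A].

Definition topo_boundary (T : topologicalType) (A : set T) : set T :=
  closure A `\` A°.

Definition partial_deriv (R : realType) (d : nat) (i : 'I_d) (f : 'rV[R]_d -> R)
    (x : 'rV[R]_d) : R :=
  'D_(delta_mx 0 i) f x.

(* A local graph representation of Om near y: in the orthonormal coordinates
   z = x *m Q, the set Om is, inside W, the strict epigraph in the direction of
   the k-th axis of a function gam of the other d - 1 coordinates. *)
Definition graph_chart (R : realType) (d : nat) (Om : set 'rV[R]_d)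
    (y : 'rV[R]_d) (W : set 'rV[R]_d) (Q : 'M[R]_d) (k : 'I_d)
    (gam : 'rV[R]_d.-1 -> R) : Prop :=
  [/\ open W, W y, Q *m Q^T = 1%:M &
      forall x, W x -> (Om x <-> gam (col' k (x *m Q)) < (x *m Q) 0 k)].

Definition Lipschitz_domain (R : realType) (d : nat) (Om : set 'rV[R]_d)
    : Prop :=
  [/\ open Om, connected Om &
      forall y, topo_boundary Om y -> exists W Q k gam,
        graph_chart Om y W Q k gam /\ lipschitz gam].

Definition C11 (R : realType) (n : nat) (gam : 'rV[R]_n -> R) : Prop :=
  (forall x : 'rV[R]_n, differentiable gam x) /\
  (forall x : 'rV[R]_n, exists2 V, nbhs x V &
     forall i, [lipschitz partial_deriv i gam z | z in V]).

(* The outer unit normal at y of the epigraph described by (Q, k, gam): in the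
   coordinates z = x *m Q it is (grad gam, -1) / sqrt (1 + |grad gam|^2), the
   entry -1 being the k-th one; right multiplication by Q^T goes back to the
   coordinates x. *)
Definition chart_normal (R : realType) (d : nat) (Q : 'M[R]_d) (k : 'I_d)
    (gam : 'rV[R]_d.-1 -> R) (y : 'rV[R]_d) : 'rV[R]_d :=
  let N : 'rV[R]_d :=
    \row_j (if unlift k j is Some i then partial_deriv i gam (col' k (y *m Q))
            else -1) in
  (enorm N)^-1 *: (N *m Q^T).

(* Gam is a relatively open C^{1,1} portion of the boundary of Om, with outer
   unit normal nu (only the values of nu on Gam matter). *)
Definition C11_patch (R : realType) (d : nat) (Om Gam : set 'rV[R]_d)
    (nu : 'rV[R]_d -> 'rV[R]_d) : Prop :=
  (exists2 V, open V & Gam = topo_boundary Om `&` V) /\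
  (forall y0, Gam y0 -> exists W Q k gam,
     [/\ graph_chart Om y0 W Q k gam, C11 gam &
         forall y, Gam y -> W y -> nu y = chart_normal Q k gam y]).

(* g, given on A, has a continuous extension to B. *)
Definition extends_continuously (T U : topologicalType) (A B : set T)
    (g : T -> U) : Prop :=
  exists2 h : T -> U, {within B, continuous h} & forall z, A z -> h z = g z.

(* f is C^1 in space and time up to Gam on the time interval I.  A function
   that is C^1 up to Gam is identified with its continuous extension to
   ((Om `&` U) `|` Gam) `*` I, whence the third item; the first derivatives
   live on the open set (Om `&` U) `*` I° and extend continuously. *)
Definition C1_upto (R : realType) (d : nat) (Om Gam : set 'rV[R]_d)
    (I : set R) (f : 'rV[R]_d -> R -> R) : Prop :=
  exists U : set 'rV[R]_d,
    let A := (Om `&` U) `*` I° in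
    let B := ((Om `&` U) `|` Gam) `*` I in
    [/\ open U, Gam `<=` U,
        {within B, continuous (fun z : 'rV[R]_d * R => f z.1 z.2)},
        (forall z, A z -> derivable (f z.1) z.2 1) /\
        extends_continuously A B (fun z => derive1 (f z.1) z.2) &
        forall i : 'I_d,
          (forall z, A z -> derivable (f ^~ z.2) z.1 (delta_mx 0 i)) /\
          extends_continuously A B (fun z => partial_deriv i (f ^~ z.2) z.1)].

Definition divergence (R : realType) (d : nat) (F : 'rV[R]_d -> 'rV[R]_d)
    (x : 'rV[R]_d) : R :=
  \sum_i partial_deriv i (fun y => F y 0 i) x.

Lemma product_measure_sigma_finite (d1 d2 : measure_display)
    (T1 : measurableType d1) (T2 : measurableType d2) (R : realType)
    (m1 : {sigma_finite_measure set T1 -> \bar R})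
    (m2 : {sigma_finite_measure set T2 -> \bar R}) :
  sigma_finite setT (m1 \x m2)%E.
Proof.
have /sigma_finiteP[F [TF ndF Foo]] := sigma_finiteT m1.
have /sigma_finiteP[G [TG ndG Goo]] := sigma_finiteT m2.
exists (fun n => F n `*` G n).
  rewrite -setXTT TF TG predeqE => -[x y]; split.
    move=> [/= [n _ Fnx] [k _ Gky]]; exists (maxn n k) => //; split.
    - by move: x Fnx; exact/subsetPset/ndF/leq_maxl.
    - by move: y Gky; exact/subsetPset/ndG/leq_maxr.
  by move=> [n _ []/= ? ?]; split; exists n.
move=> k; have [? ?] := Foo k; have [? ?] := Goo k.
split; first exact: measurableX.
by rewrite product_measure1E// lte_mul_pinfty// ge0_fin_numE.
Qed.

(* The n-fold product m^n of a sigma-finite measure m, on [n.-tuple T]. *)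
Section tuple_measure.
Context (disp : measure_display) (T : measurableType disp) (R : realType).
Variable m : {sigma_finite_measure set T -> \bar R}.

Definition cons_pair (n : nat) (x : T * n.-tuple T) : n.+1.-tuple T :=
  [tuple of x.1 :: x.2].

Lemma measurable_cons_pair n : measurable_fun setT (@cons_pair n).
Proof. exact: measurable_cons. Qed.

Section step.
Variables (n : nat) (mu : {sigma_finite_measure set (n.-tuple T) -> \bar R}).

Definition measure_cons : set (n.+1.-tuple T) -> \bar R :=
  pushforward (m \x mu)%E (@cons_pair n).

Let measure_cons0 : measure_cons set0 = 0%E.
Proof. by rewrite /measure_cons /pushforward preimage_set0 measure0. Qed.

Let measure_cons_ge0 A : (0 <= measure_cons A)%E.
Proof. by rewrite /measure_cons /pushforward. Qed.

Let measure_cons_sigma_additive : semi_sigma_additive measure_cons.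
Proof.
move=> F mF tF mUF; rewrite /measure_cons /pushforward preimage_bigcup.
apply: measure_semi_sigma_additive.
- by move=> k; rewrite -[X in measurable X]setTI; exact: measurable_cons_pair.
- apply/trivIsetP => /= i j _ _ ij; rewrite -preimage_setI.
  by move/trivIsetP : tF => /(_ _ _ _ _ ij) ->//; rewrite preimage_set0.
- rewrite -preimage_bigcup -[X in measurable X]setTI.
  exact: measurable_cons_pair.
Qed.

HB.instance Definition _ := isMeasure.Build _ _ _ measure_cons
  measure_cons0 measure_cons_ge0 measure_cons_sigma_additive.

Let measure_cons_sigma_finite : sigma_finite setT measure_cons.
Proof.
have [F TF Foo] := product_measure_sigma_finite m mu.
pose u (t : n.+1.-tuple T) : T * n.-tuple T := (thead t, [tuple of behead t]).
have uK : cancel (@cons_pair n) u.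
  move=> [x t]; rewrite /u /cons_pair /thead /= (tnth_nth x) /=.
  by congr pair; apply/val_inj.
have mu_ : measurable_fun setT u.
  apply/measurable_fun_pairP; split; first exact: measurable_tnth.
  exact: measurable_behead.
exists (fun k => u @^-1` F k).
  by rewrite -preimage_bigcup -TF preimage_setT.
move=> k; have [mFk Fk] := Foo k; split.
  by rewrite -[X in measurable X]setTI; exact: mu_.
rewrite /measure_cons /pushforward -comp_preimage.
by rewrite (_ : u \o _ = id) ?preimage_id//; apply/funext => x /=; rewrite uK.
Qed.

HB.instance Definition _ := @Measure_isSigmaFinite.Build _ _ _ measure_cons
  measure_cons_sigma_finite.

End step.

Fixpoint tuple_measure (n : nat) :
    {sigma_finite_measure set (n.-tuple T) -> \bar R} :=
  match n with
  | 0 => (\d_ [tuple] : {sigma_finite_measure set (0.-tuple T) -> \bar R})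
  | m.+1 => (measure_cons (tuple_measure m)
              : {sigma_finite_measure set (m.+1.-tuple T) -> \bar R})
  end.

Lemma tuple_measure_box (n : nat) (A : 'I_n -> set T) :
  (forall i, measurable (A i)) ->
  tuple_measure n [set t | forall i, A i (tnth t i)] =
  (\prod_i m (A i))%E.
Proof.
elim: n A => [|n IH] A mA.
  by rewrite big_ord0 /= diracE mem_set// => -[].
rewrite big_ord_recl /= /measure_cons /pushforward.
have -> : @cons_pair n @^-1` [set t | forall i, A i (tnth t i)] =
    A ord0 `*` [set t | forall i, A (lift ord0 i) (tnth t i)].
  apply/seteqP; split => [[x t] /= At|[x t] /= [Ax At] i].
    by split=> [|i]; [exact: (At ord0)|have := At (lift ord0 i); rewrite tnthS].
  by case: (unliftP ord0 i) => [j ->|->//]; rewrite tnthS.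
have mB : measurable [set t : n.-tuple T | forall i, A (lift ord0 i) (tnth t i)].
  rewrite (_ : mkset _ = \bigcap_(i in [set: 'I_n])
      ((fun t => tnth t i) @^-1` A (lift ord0 i))).
    apply: fin_bigcap_measurable => // i _.
    by rewrite -[X in measurable X]setTI; exact: measurable_tnth.
  by apply/seteqP; split => t /= h i => [_|]; exact: h.
rewrite product_measure1E//.
by congr (_ * _)%E; apply: IH => i; exact: mA.
Qed.

End tuple_measure.

Definition lebesgue_tuple (R : realType) (d : nat) :
    {sigma_finite_measure set (d.-tuple (measurableTypeR R)) -> \bar R} :=
  tuple_measure (@lebesgue_measure R) d.

Definition row_of_tuple (R : realType) (d : nat)
    (t : d.-tuple (measurableTypeR R)) : 'rV[R]_d :=
  \row_i (tnth t i : R).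

(* f is Lebesgue integrable on A: it agrees a.e. on A with a Borel function
   whose integral converges absolutely. *)
Definition L1_on (R : realType) (d : nat) (A : set 'rV[R]_d)
    (f : 'rV[R]_d -> R) : Prop :=
  exists2 g : d.-tuple (measurableTypeR R) -> R,
    (lebesgue_tuple R d).-integrable (@row_of_tuple R d @^-1` A) (EFin \o g) &
    {ae lebesgue_tuple R d, forall t,
       A (row_of_tuple t) -> f (row_of_tuple t) = g t}.

Definition vL1_on (R : realType) (d : nat) (A : set 'rV[R]_d)
    (F : 'rV[R]_d -> 'rV[R]_d) : Prop :=
  forall i, L1_on A (fun x => F x 0 i).

(* Main.v *)
Require Import Defs.
From mathcomp Require Import all_boot all_order all_algebra.
From mathcomp Require Import all_classical all_reals all_analysis.
From mathcomp Require Import measurable_realfun ring lra.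
Import Order.TTheory GRing.Theory Num.Theory.
Import numFieldNormedType.Exports.
Local Open Scope classical_set_scope.
Local Open Scope ring_scope.
Set Implicit Arguments.
Unset Strict Implicit.
Unset Printing Implicit Defensive.

(** Let F := J(., t0).  Suppose that v(., t0) = F / p is integrable on some
    collar Om `&` N of x0; it is shown that v . nu0 tends to 0.

    C^1 regularity up to Gam makes every component F_j strictly differentiable
    at a boundary point x0: there is a vector l_j, made of the boundary values
    of the partial derivatives, such that F_j y - F_j x - l_j . (y - x) is
    o(|y - x|) uniformly for x, y in Om or Gam near x0 ([C1_upto_strict]).  The
    same holds for p, so p is at most a multiple of the distance to Gam.

    Integrability forces F to vanish on Gam near x0.  If F_j y0 were nonzero at
    some y0 in Gam, then |v_j| would be at least a constant times 1 / dist near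
    y0.  The layer of points of Om at distance about 1 / (n + 1) from Gam has
    measure at least a constant times 1 / (n + 1), because it contains
    (n + 1)^(d - 1) disjoint cubes of side about 1 / (n + 1)
    ([boundary_layers]); so the integral of |v_j| over the n-th layer stays
    bounded below, although it should tend to 0 by dominated convergence
    ([quotient_not_L1_on]).

    Since F = 0 on Gam near x0, the tangential derivatives of each F_j vanish
    at x0, hence l_j = b_j nu0 for some b_j ([gradient_normal]).  Since p = 0 on
    Gam at all times, the boundary value of its time derivative is 0, and the
    continuity equation gives div F = 0 at x0, that is, b . nu0 = 0
    ([boundary_divergence0]).  The gradient of F . nu0 at x0 is
    (b . nu0) nu0 = 0, so F x . nu0 = o(dist(x, Gam)) by comparison with a
    nearly closest point of Gam.  Dividing by p >= c dist gives the claim. *)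

(** * Row vectors, inner product and distance *)

Lemma coord_le_norm (R : realType) (d : nat) (u : 'rV[R]_d) (i : 'I_d) :
  `|u 0 i| <= `|u|.
Proof.
rewrite [leRHS]mx_normrE.
exact: (@le_bigmax_cond _ _ _ _ (0, i) xpredT (fun ij : 'I_1 * 'I_d => `|u ij.1 ij.2|)).
Qed.

Lemma coordB_le_norm (R : realType) (d : nat) (u w : 'rV[R]_d) (i : 'I_d) :
  `|u 0 i - w 0 i| <= `|u - w|.
Proof. by have := coord_le_norm (u - w) i; rewrite !mxE. Qed.

Lemma rV_norm_le (R : realType) (d : nat) (u : 'rV[R]_d) (r : R) :
  0 <= r -> (forall i, `|u 0 i| <= r) -> `|u| <= r.
Proof.
move=> r0 ur; rewrite [leLHS]mx_normrE.
by apply: bigmax_le => // -[a i] _ /=; rewrite ord1.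
Qed.

Lemma edotC (R : realType) (d : nat) (u w : 'rV[R]_d) : edot u w = edot w u.
Proof. by apply: eq_bigr => i _; rewrite mulrC. Qed.

Lemma edotDr (R : realType) (d : nat) (l x y : 'rV[R]_d) :
  edot l (x + y) = edot l x + edot l y.
Proof. by rewrite /edot -big_split; apply: eq_bigr => i _; rewrite !mxE mulrDr. Qed.

Lemma edotBr (R : realType) (d : nat) (l x y : 'rV[R]_d) :
  edot l (x - y) = edot l x - edot l y.
Proof. by rewrite /edot -sumrB; apply: eq_bigr => i _; rewrite !mxE mulrBr. Qed.

Lemma edotZr (R : realType) (d : nat) (l x : 'rV[R]_d) (a : R) :
  edot l (a *: x) = a * edot l x.
Proof. by rewrite /edot mulr_sumr; apply: eq_bigr => i _; rewrite !mxE mulrCA. Qed.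

Lemma edot_delta (R : realType) (d : nat) (l : 'rV[R]_d) (i : 'I_d) :
  edot l (delta_mx 0 i) = l 0 i.
Proof.
rewrite /edot (bigD1 i)//= mxE !eqxx mulr1 big1 ?addr0// => j ji.
by rewrite mxE (negbTE ji) andbF mulr0.
Qed.

Lemma edot_mulmx_tr (R : realType) (d : nat) (l u : 'rV[R]_d) (Q : 'M[R]_d) :
  edot l (u *m Q^T) = edot (l *m Q) u.
Proof.
rewrite /edot; under eq_bigr do rewrite mxE mulr_sumr.
rewrite exchange_big/=; apply: eq_bigr => j _; rewrite mxE mulr_suml.
by apply: eq_bigr => i _; rewrite mxE mulrCA mulrC.
Qed.

Lemma norm_edot_le (R : realType) (d : nat) (u w : 'rV[R]_d) :
  `|edot u w| <= d%:R * `|u| * `|w|.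
Proof.
rewrite /edot (le_trans (ler_norm_sum _ _ _))//.
apply: (@le_trans _ _ (\sum_(i < d) (`|u| * `|w|))).
  apply: ler_sum => i _; rewrite normrM.
  by apply: ler_pM => //; exact: coord_le_norm.
by rewrite sumr_const card_ord -mulrA mulr_natl.
Qed.

Lemma norm_le_enorm (R : realType) (d : nat) (u : 'rV[R]_d) : `|u| <= enorm u.
Proof.
apply: rV_norm_le => [|i]; first exact: sqrtr_ge0.
rewrite -sqrtr_sqr ler_wsqrtr// /edot (bigD1 i)//= -expr2 lerDl.
by apply: sumr_ge0 => j _; rewrite -expr2 sqr_ge0.
Qed.

Lemma enorm_le (R : realType) (d : nat) (u : 'rV[R]_d) :
  enorm u <= d%:R * `|u|.
Proof.
rewrite /enorm -[leRHS]ger0_norm ?mulr_ge0// -sqrtr_sqr ler_wsqrtr//.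
rewrite (le_trans (ler_norm _))// (le_trans (norm_edot_le _ _))//.
rewrite -mulrA -expr2 exprMn ler_wpM2r ?sqr_ge0//.
case: d {u} => [|d]; first by rewrite expr0n.
by rewrite expr2 ler_peMr// ler1n.
Qed.

Lemma mulmx_norm_le (R : realType) (m n : nat) (M : 'M[R]_(m, n)) :
  exists2 K : R, 1 <= K & forall u : 'rV[R]_m, `|u *m M| <= K * `|u|.
Proof.
exists (1 + \sum_j \sum_i `|M i j|).
  by rewrite lerDl; do 2!apply: sumr_ge0 => ? _.
move=> u; have K0 : 0 <= 1 + \sum_j \sum_i `|M i j|.
  by rewrite addr_ge0//; do 2!apply: sumr_ge0 => ? _.
apply: rV_norm_le => [|j]; first by rewrite mulr_ge0.
rewrite mxE (le_trans (ler_norm_sum _ _ _))//.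
apply: (@le_trans _ _ (\sum_i (`|M i j| * `|u|))).
  by apply: ler_sum => i _; rewrite normrM mulrC ler_wpM2l// coord_le_norm.
rewrite -mulr_suml ler_wpM2r// (bigD1 j)//= addrCA lerDl.
by rewrite addr_ge0//; apply: sumr_ge0 => ? _//; apply: sumr_ge0 => ? _.
Qed.

Lemma dist_to_le (R : realType) (d : nat) (A : set 'rV[R]_d)
    (x y : 'rV[R]_d) :
  A y -> dist_to x A <= enorm (x - y).
Proof.
move=> Ay; apply: ge_inf; last by exists y.
by exists 0 => _ [z _ <-]; exact: sqrtr_ge0.
Qed.

Lemma dist_to_ge (R : realType) (d : nat) (A : set 'rV[R]_d)
    (x : 'rV[R]_d) (r : R) :
  A !=set0 -> (forall y, A y -> r <= enorm (x - y)) -> r <= dist_to x A.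
Proof.
move=> [y Ay] h; apply: lb_le_inf => [|_ [z Az <-]]; last exact: h.
by exists (enorm (x - y)), y.
Qed.

Lemma dist_to_approx (R : realType) (d : nat) (A : set 'rV[R]_d)
    (x : 'rV[R]_d) (e : R) :
  A !=set0 -> 0 < e -> exists2 y, A y & enorm (x - y) < dist_to x A + e.
Proof.
move=> [y Ay] e0.
have [|_ [z Az <-] ?] := @inf_adherent R [set enorm (x - y) | y in A] e e0.
  split; first by exists (enorm (x - y)), y.
  by exists 0 => _ [z _ <-]; exact: sqrtr_ge0.
by exists z.
Qed.

Lemma ball_rV (R : realType) (d : nat) (x : 'rV[R]_d) (r : R) :
  ball x r = [set y | `|x - y| < r].
Proof. by rewrite mx_norm_ball. Qed.

(** * From partial derivatives to increments *)

(** The supremum of the s in [0, 1] at which g s - g 0 obeys the bound also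
    obeys it, and if it were less than 1 then a larger s would. *)
Lemma pointwise_lipschitz_le (R : realType) (g : R -> R) (K : R) :
  (forall s, s \in `[0, 1] -> exists2 r, 0 < r &
     forall s', s' \in `[0, 1] -> `|s' - s| < r ->
       `|g s' - g s| <= K * `|s' - s|) ->
  `|g 1 - g 0| <= K.
Proof.
move=> gK.
pose S := [set s | s \in `[0, 1] /\ `|g s - g 0| <= K * s].
have S0 : S 0 by split; rewrite ?in_itv/= ?lexx ?ler01// subrr normr0 mulr0.
have S1 : ubound S 1 by move=> s [/=]; rewrite in_itv => /andP[].
have hS : has_sup S by split; [exists 0|exists 1].
pose m := sup S.
have m01 : m \in `[0, 1].
  rewrite in_itv/=; apply/andP; split; first exact: ub_le_sup hS.2 _ S0.
  exact: ge_sup hS.1 S1.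
have [r r0 mr] := gK _ m01.
have [s [s01 gs] ms] : exists2 s, S s & m - r < s := sup_adherent r0 hS.
have sm : s <= m by apply: ub_le_sup => //; exact: hS.2.
have Sm : `|g m - g 0| <= K * m.
  have /(mr _ s01) : `|s - m| < r by rewrite ler0_norm ?subr_le0//; lra.
  rewrite (ler0_norm (x := s - m)) ?subr_le0// distrC => h.
  have := ler_normD (g m - g s) (g s - g 0); rewrite subrKA.
  by move/le_trans; apply; apply: le_trans (lerD h gs) _; rewrite -mulrDr opprB subrK.
have [m1|m1] := ltP m 1; last first.
  have /eqP m_1 : m == 1 by rewrite eq_le m1 andbT; exact: ge_sup hS.1 S1.
  by move: Sm; rewrite m_1 mulr1.
pose u := Num.min 1 (m + r / 2).
have mu : m < u by rewrite lt_min m1/= ltrDl divr_gt0.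
have u01 : u \in `[0, 1].
  rewrite in_itv/= ge_min lexx/= andbT (le_trans _ (ltW mu))//.
  by move: m01; rewrite in_itv => /andP[].
have : u <= m.
  apply: ub_le_sup; first exact: hS.2.
  split=> //.
  have um : u - m < r.
    by rewrite ltrBlDl gt_min; apply/orP; right; rewrite ltrD2l; lra.
  have := mr _ u01; rewrite gtr0_norm ?subr_gt0// => /(_ um) h.
  have := ler_normD (g u - g m) (g m - g 0); rewrite subrKA.
  by move/le_trans; apply; apply: le_trans (lerD h Sm) _; rewrite -mulrDr subrK.
by rewrite leNgt mu.
Qed.

Lemma is_derive_along_line (R : realType) (d : nat) (f : 'rV[R]_d -> R)
    (x v : 'rV[R]_d) (s : R) :
  derivable f (x + s *: v) v ->
  is_derive s 1 (fun s => f (x + s *: v)) ('D_v f (x + s *: v)).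
Proof.
have E : (fun h : R => h^-1 *: (f (x + (h *: 1 + s) *: v) - f (x + s *: v))) =
         (fun h : R => h^-1 *: (f (h *: v + (x + s *: v)) - f (x + s *: v))).
  apply/funext => h; congr (_ *: (f _ - _)).
  by rewrite [h *: 1]mulr1 scalerDl addrCA.
move=> df; apply: DeriveDef; first by rewrite /derivable E.
by rewrite /derive E.
Qed.

Lemma directional_increment_le (R : realType) (d : nat) (f : 'rV[R]_d -> R)
    (x v : 'rV[R]_d) (a K : R) :
  (forall s, `|s| <= `|a| -> derivable f (x + s *: v) v /\
                             `|'D_v f (x + s *: v)| <= K) ->
  `|f (x + a *: v) - f x| <= K * `|a|.
Proof.
move=> H; pose g s := f (x + s *: v).
have H' s : s \in `[Num.min 0 a, Num.max 0 a] -> `|s| <= `|a|.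
  case: (lerP 0 a) => a0; rewrite in_itv/= => /andP[s1 s2].
    by rewrite !ger0_norm.
  by rewrite (ler0_norm s2) (ltr0_norm a0) lerN2.
have dg s : s \in `[Num.min 0 a, Num.max 0 a] ->
    is_derive s 1 g ('D_v f (x + s *: v)).
  by move=> /H' /H[df _]; exact: is_derive_along_line.
have [||c /H' /H[_ cK]] := @MVT_segment R g (fun s => 'D_v f (x + s *: v))
  (Num.min 0 a) (Num.max 0 a) _ (fun s hs => dg s (subset_itv_oo_cc hs)).
- by rewrite ge_min le_max lexx.
- by apply: derivable_within_continuous => s /dg [].
have -> : g (Num.max 0 a) - g (Num.min 0 a) = Num.sg a * (g a - g 0).
  case: (ltrgt0P a) => [a0|a0|->].
  - by rewrite gtr0_sg// mul1r.
  - by rewrite ltr0_sg// mulN1r opprB.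
  - by rewrite sgr0 mul0r subrr.
have -> : Num.max 0 a - Num.min 0 a = `|a|.
  by case: (lerP 0 a) => a0; rewrite ?subr0 ?sub0r ?(ger0_norm a0) ?(ltr0_norm a0).
rewrite /g scale0r addr0 => E.
have := congr1 Num.norm E; rewrite !normrM normr_id normr_sg.
case: eqP => [-> _|_]; first by rewrite scale0r addr0 subrr !normr0 mulr0.
by rewrite mul1r => ->; rewrite ler_wpM2r.
Qed.

(** Moving from x to y one coordinate at a time stays in the ball, so bounded
    partial derivatives alone control the increment, without
    differentiability. *)
Lemma ball_increment_le (R : realType) (d : nat) (f : 'rV[R]_d -> R)
    (x y : 'rV[R]_d) (r K : R) :
  (forall z, `|z - x| < r -> forall i : 'I_d,
     derivable f z (delta_mx 0 i) /\ `|partial_deriv i f z| <= K) ->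
  `|y - x| < r -> `|f y - f x| <= d%:R * K * `|y - x|.
Proof.
move=> H yx.
(* w m has the first m entries of y and the other entries of x *)
pose w (m : nat) : 'rV[R]_d := \row_i (if (i < m)%N then y 0 i else x 0 i).
have w0 : w 0%N = x by apply/rowP => i; rewrite mxE.
have wd : w d = y by apply/rowP => i; rewrite mxE ltn_ord.
have step (i : 'I_d) : `|f (w i.+1) - f (w i)| <= K * `|y - x|.
  have -> : w i.+1 = w i + (y 0 i - x 0 i) *: delta_mx 0 i.
    apply/rowP => j; rewrite !mxE eqxx/= ltnS leq_eqVlt.
    rewrite -val_eqE/=; case: ltngtP => ji; rewrite ?mulr0 ?addr0//.
    by rewrite (val_inj ji) mulr1 subrKC.
  have K0 : 0 <= K.
    have /(_ _ i)[//|_] := H x; first by rewrite subrr normr0 (le_lt_trans _ yx).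
    exact: le_trans.
  apply: (@le_trans _ _ (K * `|y 0 i - x 0 i|)); last first.
    rewrite ler_wpM2l//; exact: coordB_le_norm.
  apply: directional_increment_le => s si; apply: H.
  apply: le_lt_trans yx; apply: rV_norm_le => // j.
  rewrite !mxE eqxx/=; case: ltngtP => ji.
  - rewrite -val_eqE/= (ltn_eqF ji) mulr0 addr0.
    exact: coordB_le_norm.
  - by rewrite -val_eqE/= (gtn_eqF ji) mulr0 addr0 subrr normr0.
  - rewrite -val_eqE/= ji eqxx mulr1 addrAC subrr add0r (le_trans si)//.
    exact: coordB_le_norm.
rewrite -{1}wd -{1}w0 -(telescope_sumr (f \o w))// big_mkord.
rewrite (le_trans (ler_norm_sum _ _ _))//.
apply: (@le_trans _ _ (\sum_(i < d) (K * `|y - x|))).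
  by apply: ler_sum => i _; exact: step.
by rewrite sumr_const card_ord -mulrA mulr_natl.
Qed.

Lemma segment_increment_le (R : realType) (d : nat) (f : 'rV[R]_d -> R)
    (O : set 'rV[R]_d) (x y : 'rV[R]_d) (K : R) :
  open O ->
  (forall z, O z -> forall i : 'I_d,
     derivable f z (delta_mx 0 i) /\ `|partial_deriv i f z| <= K) ->
  (forall s, s \in `[0, 1] -> O (x + s *: (y - x))) ->
  `|f y - f x| <= d%:R * K * `|y - x|.
Proof.
move=> oO H seg.
have := @pointwise_lipschitz_le R (fun s => f (x + s *: (y - x))) (d%:R * K * `|y - x|).
rewrite scale0r addr0 scale1r subrKC; apply => s s01.
have /nbhs_ballP[r /= r0 rO] : nbhs (x + s *: (y - x)) O.
  by apply: open_nbhs_nbhs; split=> //; exact: seg.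
have xy0 : 0 < 1 + `|y - x| by rewrite ltr_pwDl.
exists (r / (1 + `|y - x|)) => [|s' s'01 ss']; first by rewrite divr_gt0.
have E : x + s' *: (y - x) - (x + s *: (y - x)) = (s' - s) *: (y - x).
  by rewrite opprD addrACA subrr add0r -scalerBl.
rewrite -mulrA [_ * `|s' - s|]mulrC -normrZ -E.
apply: ball_increment_le => [z zr|].
  by apply: H; apply: rO; rewrite ball_rV/= distrC; exact: zr.
rewrite E normrZ; move: ss'; rewrite ltr_pdivlMr//; apply: le_lt_trans.
by rewrite ler_wpM2l// lerDr.
Qed.

(** * Boundary points in a graph chart *)

(** The inverse of the splitting of a vector into its k-th entry and its other
    entries [col' k]. *)
Definition insert_coord (R : realType) (d : nat) (k : 'I_d)
    (z : 'rV[R]_d.-1) (h : R) : 'rV[R]_d :=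
  \row_j (if unlift k j is Some i then z 0 i else h).

Lemma col'_insert_coord (R : realType) (d : nat) (k : 'I_d)
    (z : 'rV[R]_d.-1) (h : R) : col' k (insert_coord k z h) = z.
Proof. by apply/rowP => i; rewrite !mxE liftK. Qed.

Lemma insert_coord_k (R : realType) (d : nat) (k : 'I_d)
    (z : 'rV[R]_d.-1) (h : R) : insert_coord k z h 0 k = h.
Proof. by rewrite mxE unlift_none. Qed.

Lemma insert_coordK (R : realType) (d : nat) (k : 'I_d) (z : 'rV[R]_d) :
  insert_coord k (col' k z) (z 0 k) = z.
Proof. by apply/rowP => j; rewrite !mxE; case: unliftP => [i ->|->]; rewrite ?mxE. Qed.

Lemma norm_col'_le (R : realType) (d : nat) (k : 'I_d) (z : 'rV[R]_d) :
  `|col' k z| <= `|z|.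
Proof. by apply: rV_norm_le => // i; rewrite mxE; exact: coord_le_norm. Qed.

(** Signed height over the graph, along the axis: Om is locally the set where
    it is positive *)
Definition height (R : realType) (d : nat) (Q : 'M[R]_d) (k : 'I_d)
    (gam : 'rV[R]_d.-1 -> R) (x : 'rV[R]_d) : R :=
  (x *m Q) 0 k - gam (col' k (x *m Q)).

(** The direction of the graph's vertical axis, in the original coordinates *)
Definition graph_axis (R : realType) (d : nat) (Q : 'M[R]_d) (k : 'I_d) :
    'rV[R]_d := delta_mx 0 k *m Q^T.

Lemma col'_delta (R : realType) (d : nat) (k : 'I_d) :
  col' k (delta_mx 0 k : 'rV[R]_d) = 0.
Proof. by apply/rowP => i; rewrite !mxE eqxx /= eq_sym (negbTE (neq_lift k i)). Qed.

Lemma graph_axisQ (R : realType) (d : nat) (Q : 'M[R]_d) (k : 'I_d)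
    (x : 'rV[R]_d) (s : R) : Q *m Q^T = 1%:M ->
  (x + s *: graph_axis Q k) *m Q = x *m Q + s *: delta_mx 0 k.
Proof.
move=> /mulmx1C QQ.
by rewrite mulmxDl -scalemxAl /graph_axis -mulmxA QQ mulmx1.
Qed.

Lemma height_graph_axis (R : realType) (d : nat) (Q : 'M[R]_d) (k : 'I_d)
    (gam : 'rV[R]_d.-1 -> R) (x : 'rV[R]_d) (s : R) : Q *m Q^T = 1%:M ->
  height Q k gam (x + s *: graph_axis Q k) = height Q k gam x + s.
Proof.
move=> QQ; rewrite /height graph_axisQ// linearD/= linearZ/= col'_delta.
by rewrite scaler0 addr0 !mxE !eqxx/= mulr1 addrAC.
Qed.

Lemma lipschitz_bound (R : realType) (n : nat) (gam : 'rV[R]_n -> R) :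
  lipschitz gam ->
  exists2 L : R, 0 <= L & forall a b, `|gam a - gam b| <= L * `|a - b|.
Proof.
move=> [M [_ /(_ (`|M| + 1))]] H.
exists (`|M| + 1) => [|a b]; first by rewrite addr_ge0.
have /H : M < `|M| + 1 by rewrite ltr_pwDr// ler_norm.
by move=> /(_ (a, b)); apply.
Qed.

Lemma bounded_increment_continuous (R : realType) (U V : normedModType R) (f : U -> V)
    (K : R) : (forall a b, `|f a - f b| <= K * `|a - b|) -> continuous f.
Proof.
move=> fK x; apply/cvgrPdist_lt => e e0.
have K0 : 0 < `|K| + 1 by rewrite ltr_pwDr.
near=> y; apply: le_lt_trans (fK _ _) _.
apply: (@le_lt_trans _ _ ((`|K| + 1) * `|x - y|)).
  by rewrite ler_wpM2r// ler_wpDr// ler_norm.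
rewrite mulrC -ltr_pdivlMr//; near: y.
by apply: (@cvgr_dist_lt _ _ _ (nbhs x) _ id x) => //; rewrite divr_gt0.
Unshelve. all: by end_near. Qed.

Lemma edot_continuous (R : realType) (d : nat) (l : 'rV[R]_d) :
  continuous (edot l).
Proof.
apply: (@bounded_increment_continuous _ _ _ _ (d%:R * `|l|)) => a b.
by rewrite -edotBr norm_edot_le.
Qed.

Lemma mulmx_continuous (R : realType) (m n : nat) (M : 'M[R]_(m, n)) :
  continuous (fun u : 'rV[R]_m => u *m M).
Proof.
have [K _ MK] := mulmx_norm_le M.
apply: (@bounded_increment_continuous _ _ _ _ K) => a b.
by rewrite -mulmxBl.
Qed.

Lemma height_lipschitz (R : realType) (d : nat) (Q : 'M[R]_d) (k : 'I_d)
    (gam : 'rV[R]_d.-1 -> R) : lipschitz gam ->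
  exists2 H : R, 0 <= H &
    forall x y, `|height Q k gam x - height Q k gam y| <= H * `|x - y|.
Proof.
move=> /lipschitz_bound[L L0 gL]; have [K K1 QK] := mulmx_norm_le Q.
have K0 : 0 <= K by rewrite (le_trans _ K1).
exists (K + L * K) => [|x y]; first by rewrite addr_ge0// mulr_ge0.
have E (a b a' b' : R) : a - b - (a' - b') = (a - a') - (b - b') by ring.
rewrite /height E.
rewrite (le_trans (ler_normB _ _))// mulrDl lerD//.
  apply: le_trans (QK (x - y)); rewrite mulmxBl.
  exact: coordB_le_norm.
rewrite (le_trans (gL _ _))// -mulrA ler_wpM2l//.
rewrite -linearB/= -mulmxBl; apply: le_trans (norm_col'_le _ _) _.
exact: QK.
Qed.

Lemma height_continuous (R : realType) (d : nat) (Q : 'M[R]_d) (k : 'I_d)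
    (gam : 'rV[R]_d.-1 -> R) : continuous gam -> continuous (height Q k gam).
Proof.
have ck : continuous (fun z : 'rV[R]_d => z 0 k).
  apply: (@bounded_increment_continuous _ _ _ _ 1) => a b.
  by rewrite mul1r; exact: coordB_le_norm.
have cc : continuous (fun z : 'rV[R]_d => col' k z).
  apply: (@bounded_increment_continuous _ _ _ _ 1) => a b.
  by rewrite mul1r -linearB/= norm_col'_le.
move=> cg x; have cQ := @mulmx_continuous _ _ _ Q x.
have h1 : (fun u => (u *m Q) 0 k) @ x --> (x *m Q) 0 k.
  apply: (@cvg_comp _ _ _ (fun u => u *m Q) (fun z : 'rV[R]_d => z 0 k)
    _ _ _ cQ).
  exact: ck.
have h2 : (fun u => col' k (u *m Q)) @ x --> col' k (x *m Q).
  apply: (@cvg_comp _ _ _ (fun u => u *m Q) (fun z : 'rV[R]_d => col' k z)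
    _ _ _ cQ).
  exact: cc.
have h3 : (fun u => gam (col' k (u *m Q))) @ x --> gam (col' k (x *m Q)).
  by apply: (@cvg_comp _ _ _ (fun u => col' k (u *m Q)) gam _ _ _ h2); exact: cg.
exact: (@cvgB _ _ _ (nbhs x) _ _ _ _ _ h1 h3).
Qed.

Lemma graph_chart_height (R : realType) (d : nat) (Om : set 'rV[R]_d)
    (y : 'rV[R]_d) (W : set 'rV[R]_d) (Q : 'M[R]_d) (k : 'I_d)
    (gam : 'rV[R]_d.-1 -> R) (x : 'rV[R]_d) :
  graph_chart Om y W Q k gam -> W x -> Om x <-> 0 < height Q k gam x.
Proof. by move=> [_ _ _ h] /h ->; rewrite subr_gt0. Qed.

Lemma boundary_height0 (R : realType) (d : nat) (Om : set 'rV[R]_d)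
    (y : 'rV[R]_d) (W : set 'rV[R]_d) (Q : 'M[R]_d) (k : 'I_d)
    (gam : 'rV[R]_d.-1 -> R) (x : 'rV[R]_d) :
  open Om -> graph_chart Om y W Q k gam -> continuous (height Q k gam) ->
  topo_boundary Om x -> W x -> height Q k gam x = 0.
Proof.
move=> oOm ch ch_cont [clx nOmx] Wx; have [oW _ _ _] := ch.
apply/eqP; rewrite eq_le; apply/andP; split.
  rewrite leNgt; apply/negP => /(graph_chart_height ch Wx).2 Omx; apply: nOmx.
  exact: open_nbhs_nbhs.
rewrite leNgt; apply/negP => hx.
have N1 : nbhs x [set z | height Q k gam z < 0].
  by have /cvgr_lt := ch_cont x; apply.
have [z [Omz [/= hz Wz]]] := clx _ (filterI N1 (open_nbhs_nbhs (conj oW Wx))).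
by move/(graph_chart_height ch Wz).1 : Omz; rewrite ltNge (ltW hz).
Qed.

(** A point of zero height is a limit of points of Om, reached along the
    axis. *)
Lemma height0_boundary (R : realType) (d : nat) (Om : set 'rV[R]_d)
    (y : 'rV[R]_d) (W : set 'rV[R]_d) (Q : 'M[R]_d) (k : 'I_d)
    (gam : 'rV[R]_d.-1 -> R) (x : 'rV[R]_d) :
  open Om -> graph_chart Om y W Q k gam -> W x -> height Q k gam x = 0 ->
  topo_boundary Om x.
Proof.
move=> oOm ch Wx hx; have [oW _ QQ _] := ch; split; last first.
  move=> /interior_subset /(graph_chart_height ch Wx).1.
  by rewrite hx ltxx.
move=> B nB.
have : \forall s \near (0 : R)^'+, (B `&` W) (x + s *: graph_axis Q k).
  have : x + s *: graph_axis Q k @[s --> (0 : R)^'+] --> x.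
    rewrite -[X in _ --> X]addr0 -(scale0r (graph_axis Q k)).
    apply: cvgD; first exact: cvg_cst.
    apply: cvgZr_tmp; exact: cvg_within.
  by move/(_ _ (filterI nB (open_nbhs_nbhs (conj oW Wx)))).
move=> near0; near (0 : R)^'+ => s.
have [Bs Ws] : (B `&` W) (x + s *: graph_axis Q k) by near: s.
exists (x + s *: graph_axis Q k); split => //.
by apply/(graph_chart_height ch Ws); rewrite height_graph_axis// hx add0r.
Unshelve. all: by end_near. Qed.

(** * Strict differentiability up to the boundary *)

(** The contraction towards t0 maps a ball of I around t1 into I, even if t0 is
    an endpoint of I. *)
Lemma interior_interval_toward (R : realType) (I : set R) (t0 t1 s : R) :
  is_interval I -> I t0 -> I° t1 -> 0 < s -> s <= 1 ->
  I° (t0 + s * (t1 - t0)).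
Proof.
move=> iI It0 /nbhs_ballP[r /= r0 rI] s0 s1.
apply/nbhs_ballP; exists (s * r); first by rewrite /= mulr_gt0.
move=> w; rewrite /ball/= => wr.
pose w' := t1 + (w - (t0 + s * (t1 - t0))) / s.
have Iw' : I w'.
  apply: rI; rewrite /ball/= /w' opprD addrA subrr add0r normrN normrM.
  by rewrite normfV (gtr0_norm s0) ltr_pdivrMr// distrC [r * s]mulrC.
have wE : w = t0 + s * (w' - t0) by rewrite /w'; field; rewrite gt_eqF.
have [tw|tw] := leP t0 w'.
  apply: (iI t0 w') => //; rewrite wE.
  have h1 : 0 <= (1 - s) * (w' - t0) by apply: mulr_ge0; rewrite subr_ge0.
  have h2 : 0 <= s * (w' - t0) by apply: mulr_ge0; rewrite ?subr_ge0// ltW.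
  by apply/andP; split; lra.
apply: (iI w' t0) => //; rewrite wE.
have h1 : 0 <= (1 - s) * (t0 - w') by apply: mulr_ge0; rewrite subr_ge0// ltW.
have h2 : 0 <= s * (t0 - w') by apply: mulr_ge0; rewrite ?subr_ge0 ltW.
by apply/andP; split; lra.
Qed.

(** The derivatives of a function that is C^1 up to Gam are given only at points
    of Om `*` I°; their boundary values are limits along this filter. *)
Definition inner_nbhs (R : realType) (d : nat) (Om : set 'rV[R]_d) (I : set R)
    (z0 : 'rV[R]_d * R) : set_system ('rV[R]_d * R) :=
  within (Om `*` I°) (nbhs z0).

Lemma prod_ballP (R : realType) (d : nat) (z0 : 'rV[R]_d * R)
    (P : set ('rV[R]_d * R)) :
  nbhs z0 P <-> exists2 r : R, 0 < r &
    forall x t, `|x - z0.1| < r -> `|t - z0.2| < r -> P (x, t).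
Proof.
split=> [/nbhs_ballP[r /= r0 rP]|[r r0 rP]].
  exists r => // x t xr tr; apply: rP; split; last by rewrite /ball/= distrC.
  by rewrite ball_rV/= distrC.
apply/nbhs_ballP; exists r => //= -[x t] [/=].
rewrite ball_rV /ball/= => xr tr; apply: rP; rewrite distrC//.
Qed.

Lemma inner_nbhs_proper (R : realType) (d : nat) (Om : set 'rV[R]_d)
    (I : set R) (x0 : 'rV[R]_d) (t0 : R) :
  closure Om x0 -> is_interval I -> I° !=set0 -> I t0 ->
  ProperFilter (inner_nbhs Om I (x0, t0)).
Proof.
move=> clx iI [t1 It1] It0; apply: Build_ProperFilter_ex => P.
move=> /prod_ballP[r r0 rP].
have [x [Omx xr]] := clx _ (nbhsx_ballx x0 r r0).
pose s := Num.min 1 (r / (1 + `|t1 - t0|) / 2).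
have a0 : 0 < 1 + `|t1 - t0| by rewrite ltr_pwDl.
have s0 : 0 < s by rewrite lt_min ltr01 !divr_gt0.
exists (x, t0 + s * (t1 - t0)); apply: rP => /=.
- by move: xr; rewrite ball_rV/= distrC.
- rewrite addrC addKr normrM (gtr0_norm s0).
  apply: (@le_lt_trans _ _ (r / (1 + `|t1 - t0|) / 2 * (1 + `|t1 - t0|))).
    by apply: ler_pM; rewrite ?ge_min ?lexx ?orbT ?lerDr// ltW.
  by rewrite mulrAC divfK ?gt_eqF// ltr_pdivrMr//; lra.
- by split => //=; apply: interior_interval_toward; rewrite // ge_min lexx.
Qed.

Lemma near_fst (R : realType) (d : nat) (U : set 'rV[R]_d)
    (x0 : 'rV[R]_d) (t0 : R) :
  nbhs x0 U -> \forall z \near (x0, t0), U z.1.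
Proof.
move=> /nbhs_ballP[r /= r0 rU]; apply/prod_ballP; exists r => // x t /= xr _.
by apply: rU; rewrite ball_rV/= distrC.
Qed.

Lemma extends_continuously_cvg (R : realType) (d : nat)
    (Om U Gam : set 'rV[R]_d) (I : set R) (g : 'rV[R]_d * R -> R)
    (x0 : 'rV[R]_d) (t0 : R) :
  extends_continuously ((Om `&` U) `*` I°) (((Om `&` U) `|` Gam) `*` I) g ->
  nbhs x0 U -> Gam x0 -> I t0 ->
  exists a : R, g z @[z --> inner_nbhs Om I (x0, t0)] --> a.
Proof.
move=> [h /subspace_continuousP hc hE] Ux0 Gx0 It0; exists (h (x0, t0)).
have /cvgrPdist_le hB := hc (x0, t0) (conj (or_intror Gx0) It0).
apply/cvgrPdist_le => e e0; have := hB e e0; rewrite !near_withinE => hn.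
have hU := near_fst t0 Ux0.
near=> z => -[Omz Iz].
have Uz : U z.1 by near: z.
rewrite -hE; last by split.
have : (((Om `&` U) `|` Gam) `*` I) z by split; [left|exact: interior_subset].
by near: z.
Unshelve. all: by end_near. Qed.

Lemma C1_upto_partials (R : realType) (d : nat) (Om Gam : set 'rV[R]_d)
    (I : set R) (f : 'rV[R]_d -> R -> R) (x0 : 'rV[R]_d) (t0 : R) :
  C1_upto Om Gam I f -> Gam x0 -> I t0 ->
  exists l : 'rV[R]_d, forall i : 'I_d,
    partial_deriv i (f ^~ z.2) z.1 @[z --> inner_nbhs Om I (x0, t0)] --> l 0 i.
Proof.
move=> [U [oU GU _ _ H]] Gx0 It0.
have Ux0 : nbhs x0 U by apply: open_nbhs_nbhs; split=> //; exact: GU.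
have [l lP] := choice (fun i => extends_continuously_cvg (H i).2 Ux0 Gx0 It0).
by exists (\row_i l i) => i; rewrite mxE; exact: lP.
Qed.

Lemma is_derive_edot (R : realType) (d : nat) (l z v : 'rV[R]_d) :
  is_derive z v (edot l) (edot l v).
Proof.
have D : h^-1 *: (edot l (h *: v + z) - edot l z) @[h --> (0 : R)^'] --> edot l v.
  apply: cvg_near_cst; near=> h.
  have h0 : h != 0 by near: h; exact: nbhs_dnbhs_neq.
  rewrite /edot -sumrB; rewrite scaler_sumr.
  apply: eq_bigr => i _; rewrite !mxE mulrDr addrK /GRing.scale/= mulrCA.
  by rewrite mulKf.
apply: DeriveDef; first by apply/cvg_ex; exists (edot l v).
exact: cvg_lim D.
Unshelve. all: by end_near. Qed.

Lemma norm_segment_lt (R : realType) (V : normedModType R) (x y x0 : V)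
    (s r : R) : 0 <= s -> s <= 1 -> `|x - x0| < r -> `|y - x0| < r ->
  `|x + s *: (y - x) - x0| < r.
Proof.
move=> s0 s1 xr yr.
have -> : x + s *: (y - x) - x0 = (1 - s) *: (x - x0) + s *: (y - x0).
  have -> : y - x = (y - x0) - (x - x0) by rewrite opprB subrKA.
  rewrite addrAC; move: (x - x0) (y - x0) => a b.
  by rewrite scalerBl scale1r scalerBr -addrA [- _ + _]addrC.
rewrite (le_lt_trans (ler_normD _ _))// !normrZ !ger0_norm ?subr_ge0//.
have [->|sn0] := eqVneq s 0; first by rewrite subr0 mul1r mul0r addr0.
have -> : r = (1 - s) * r + s * r by ring.
apply: ler_ltD; first by rewrite ler_wpM2l ?subr_ge0// ltW.
by rewrite ltr_pM2l// lt_def sn0.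
Qed.

(** At times in I° this is [segment_increment_le] for [f ^~ t - edot l]. Times
    of I and endpoints on Gam are reached as limits, moving the endpoints of
    the segment inwards and the time towards an interior point at once. *)
Lemma C1_upto_segment (R : realType) (d : nat) (Om Gam : set 'rV[R]_d)
    (I : set R) (f : 'rV[R]_d -> R -> R) (x0 l : 'rV[R]_d) (t0 e : R) :
  open Om -> is_interval I -> I° !=set0 ->
  C1_upto Om Gam I f -> Gam x0 -> I t0 ->
  (forall i : 'I_d, partial_deriv i (f ^~ z.2) z.1
     @[z --> inner_nbhs Om I (x0, t0)] --> l 0 i) ->
  0 < e ->
  exists2 r, 0 < r & forall x y, (Om `|` Gam) x -> (Om `|` Gam) y ->
    `|x - x0| < r -> `|y - x0| < r ->
    (forall s, 0 < s -> s < 1 -> Om (x + s *: (y - x))) ->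
    `|f y t0 - f x t0 - edot l (y - x)| <= e * `|y - x|.
Proof.
move=> oOm iI [t1 It1] [U [oU GU /subspace_continuousP fc _ fd]] Gx0 It0 fl e0.
have d0 : 0 < d%:R + 1 :> R by rewrite ltr_wpDl.
have Ux0 : nbhs x0 U by apply: open_nbhs_nbhs; split=> //; exact: GU.
have hU := near_fst t0 Ux0.
have hp : \forall z \near (x0, t0), forall i : 'I_d, (Om `*` I°) z ->
    `|l 0 i - partial_deriv i (f ^~ z.2) z.1| <= e / (d%:R + 1).
  apply: (@filter_forall _ _ (fun i z => (Om `*` I°) z ->
    `|l 0 i - partial_deriv i (f ^~ z.2) z.1| <= e / (d%:R + 1))
    (nbhs (x0, t0))) => i.
  have /cvgrPdist_le/(_ _ (divr_gt0 e0 d0)) := fl i.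
  by rewrite near_withinE.
have [r r0 rP] := (prod_ballP _ _).1 (filterI hU hp).
have t0r : `|t0 - t0| < r by rewrite subrr normr0.
have inner x y t : I° t -> `|t - t0| < r -> `|x - x0| < r -> `|y - x0| < r ->
    (forall s, s \in `[0, 1] -> Om (x + s *: (y - x))) ->
    `|f y t - f x t - edot l (y - x)| <= e * `|y - x|.
  move=> It tr xr yr seg.
  have -> : f y t - f x t - edot l (y - x) =
      (f ^~ t - edot l) y - (f ^~ t - edot l) x.
    by rewrite edotBr /= !fctE; ring.
  apply: (@le_trans _ _ (d%:R * (e / (d%:R + 1)) * `|y - x|)); last first.
    rewrite ler_wpM2r// mulrCA ler_piMr// ?ltW//.
    by rewrite ltr_pdivrMr// mul1r ltrDl.
  apply: (@segment_increment_le _ _ _ (Om `&` ball x0 r)).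
  - by apply: openI => //; exact: ball_open.
  - move=> z [Omz]; rewrite ball_rV/= distrC => zr i.
    have [Uz /(_ i) hz] := rP z t zr tr.
    have fdz : derivable (f ^~ t) z (delta_mx 0 i).
      exact: ((fd i).1 (z, t) (conj (conj Omz Uz) It)).
    have [ded edE] := is_derive_edot l z (delta_mx 0 i).
    split; first exact: derivableB.
    rewrite /partial_deriv deriveB// edE edot_delta distrC.
    exact: hz.
  - move=> s s01; split; first exact: seg.
    move: s01; rewrite in_itv/= => /andP[s0 s1].
    by rewrite ball_rV/= distrC; exact: norm_segment_lt.
exists r => // x y Ox Oy xr yr seg.
(* both endpoints are moved inwards along the segment, by the fraction s *)
pose xs (s : R) := x + s *: (y - x).
pose ys (s : R) := y + s *: (x - y).
pose ts (s : R) := t0 + s * (t1 - t0).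
have path_cvg (V : normedModType R) (a b : V) :
    a + s *: b @[s --> (0 : R)^'+] --> a.
  rewrite -[X in _ --> X]addr0 -(scale0r b); apply: cvgD; first exact: cvg_cst.
  by apply: cvgZr_tmp; exact: cvg_within.
have f_cvg a b : (Om `|` Gam) a -> `|a - x0| < r ->
    (forall s, 0 < s -> s < 1 -> Om (a + s *: (b - a)) /\ `|a + s *: (b - a) - x0| < r) ->
    f (a + s *: (b - a)) (ts s) @[s --> (0 : R)^'+] --> f a t0.
  move=> Oa ar segab.
  have Ba : (((Om `&` U) `|` Gam) `*` I) (a, t0).
    split => //=; case: Oa => [Oma|]; last by right.
    by left; split => //; exact: (rP a t0 ar t0r).1.
  apply: (@cvg_comp _ _ _ (fun s => (a + s *: (b - a), ts s))
    (fun z => f z.1 z.2) _ _ _ _ (fc _ Ba)) => P /prod_ballP[q q0 qP].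
  have na := path_cvg _ a (b - a).
  have nt : ts s @[s --> (0 : R)^'+] --> t0 := path_cvg R^o t0 (t1 - t0).
  change (\forall s \near (0 : R)^'+, P (a + s *: (b - a), ts s)).
  near=> s.
  have s0 : 0 < s by near: s; exact: nbhs_right_gt.
  have s1 : s < 1 by near: s; exact: nbhs_right_lt.
  have [Os rs] := segab _ s0 s1.
  apply: qP => /=.
  - by rewrite distrC; near: s; exact: cvgr_dist_lt na _ q0.
  - by rewrite distrC; near: s; exact: cvgr_dist_lt nt _ q0.
  - split => /=; last first.
      by apply: interior_subset; apply: interior_interval_toward => //; exact: ltW.
    by left; split => //; exact: (rP _ t0 rs t0r).1.
have segx s : 0 < s -> s < 1 -> Om (xs s) /\ `|xs s - x0| < r.
  by move=> s0 s1; split; [exact: seg|apply: norm_segment_lt => //; exact: ltW].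
have ysE s : ys s = xs (1 - s).
  rewrite /xs /ys scalerBl scale1r addrA subrKC.
  by rewrite -scalerN opprB.
have segy s : 0 < s -> s < 1 -> Om (ys s) /\ `|ys s - x0| < r.
  by move=> s0 s1; rewrite ysE; apply: segx; rewrite ?subr_gt0// gtrBl.
have fx := f_cvg x y Ox xr segx.
have fy := f_cvg y x Oy yr segy.
have cx : xs s @[s --> (0 : R)^'+] --> x := path_cvg _ x (y - x).
have cy : ys s @[s --> (0 : R)^'+] --> y := path_cvg _ y (x - y).
have cxy : ys s - xs s @[s --> (0 : R)^'+] --> y - x by exact: cvgB cy cx.
have cl : edot l (ys s - xs s) @[s --> (0 : R)^'+] --> edot l (y - x).
  by apply: (@cvg_comp _ _ _ _ (edot l) _ _ _ cxy); exact: edot_continuous.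
have cL : `|f (ys s) (ts s) - f (xs s) (ts s) - edot l (ys s - xs s)|
    @[s --> (0 : R)^'+] --> `|f y t0 - f x t0 - edot l (y - x)|.
  by apply: cvg_norm; apply: cvgB cl; exact: cvgB fy fx.
have cR : e * `|ys s - xs s| @[s --> (0 : R)^'+] --> e * `|y - x|.
  by apply: cvgMr; exact: cvg_norm.
have ct : ts s @[s --> (0 : R)^'+] --> t0 := path_cvg R^o t0 (t1 - t0).
apply: (ler_cvg_to cL cR); near=> s.
have s0 : 0 < s by near: s; exact: nbhs_right_gt.
have s2 : s < 1 / 2 by near: s; apply: nbhs_right_lt.
have s1 : s < 1 by lra.
apply: inner.
- by apply: interior_interval_toward => //; exact: ltW.
- by near: s; exact: cvgr_distC_lt ct _ r0.
- exact: (segx s s0 s1).2.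
- exact: (segy s s0 s1).2.
- move=> u; rewrite in_itv/= => /andP[u0 u1].
  have -> : xs s + u *: (ys s - xs s) = xs (s + u * (1 - 2 * s)).
    rewrite ysE /xs opprD addrACA subrr add0r -scalerBl scalerA -addrA -scalerDl.
    by congr (_ + _ *: _); ring.
  have h1 : 0 <= u * (1 - 2 * s) by rewrite mulr_ge0//; lra.
  have h2 : 0 <= (1 - u) * (1 - 2 * s) by rewrite mulr_ge0//; lra.
  by apply: (segx _ _ _).1; lra.
Unshelve. all: by end_near. Qed.

(** The segment between x and y may leave Om, so both points are first lifted
    along the axis of the graph by a multiple of `|y - x|: this brings the
    segment between the lifted points inside Om, and the length of the detour
    is comparable to `|y - x|. *)
Lemma C1_upto_strict (R : realType) (d : nat) (Om Gam : set 'rV[R]_d)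
    (I : set R) (f : 'rV[R]_d -> R -> R) (x0 l : 'rV[R]_d) (t0 : R)
    (W : set 'rV[R]_d) (Q : 'M[R]_d) (k : 'I_d) (gam : 'rV[R]_d.-1 -> R)
    (e : R) :
  open Om -> Gam `<=` topo_boundary Om ->
  graph_chart Om x0 W Q k gam -> lipschitz gam ->
  is_interval I -> I° !=set0 ->
  C1_upto Om Gam I f -> Gam x0 -> I t0 ->
  (forall i : 'I_d, partial_deriv i (f ^~ z.2) z.1
     @[z --> inner_nbhs Om I (x0, t0)] --> l 0 i) ->
  0 < e ->
  exists2 r, 0 < r & forall x y, (Om `|` Gam) x -> (Om `|` Gam) y ->
    `|x - x0| < r -> `|y - x0| < r ->
    `|f y t0 - f x t0 - edot l (y - x)| <= e * `|y - x|.
Proof.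
move=> oOm GO ch lgam iI I0 fC1 Gx0 It0 fl e0.
have [oW Wx0 QQ _] := ch.
have [H H0 hH] := height_lipschitz Q k lgam.
have hc : continuous (height Q k gam) by exact: bounded_increment_continuous hH.
pose ax := graph_axis Q k; pose M := H + 1.
have M0 : 0 < M by rewrite ltr_wpDl.
(* the length of the path x, x1, y1, y built below is at most C * `|y - x| *)
pose C := 1 + 2 * (M * `|ax|).
have C0 : 0 < C by rewrite ltr_pwDl// mulr_ge0// mulr_ge0// ltW.
have [r1 r10 hr1] := C1_upto_segment oOm iI I0 fC1 Gx0 It0 fl (divr_gt0 e0 C0).
have /nbhs_ballP[r2 /= r20 hr2] : nbhs x0 W by exact: open_nbhs_nbhs.
have inW z : `|z - x0| < r2 -> W z by rewrite distrC => zr; apply: hr2; rewrite ball_rV.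
pose r := Num.min r1 r2 / C.
have r0 : 0 < r by rewrite divr_gt0// lt_min r10.
have rC : r * C = Num.min r1 r2 by rewrite divfK// gt_eqF.
exists r => // x y Ox Oy xr yr.
have [->|yx] := eqVneq y x.
  by rewrite edotBr !subrr !normr0 mulr0.
pose D := `|y - x|.
have D0 : 0 < D by rewrite normr_gt0 subr_eq0.
have D2r : D < 2 * r.
  rewrite /D -(subrKA x0) (le_lt_trans (ler_normD _ _))// [`|x0 - x|]distrC.
  by rewrite mulr2n mulrDl !mul1r ltrD.
pose T := M * D.
have T0 : 0 < T by rewrite mulr_gt0.
have height_ge0 z : (Om `|` Gam) z -> W z -> 0 <= height Q k gam z.
  move=> [Oz|Gz] Wz; first by rewrite ltW//; apply/(graph_chart_height ch Wz).
  by rewrite (boundary_height0 oOm ch hc (GO _ Gz) Wz).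
have near_lift z s : `|z - x0| < r -> 0 <= s -> s <= T ->
    `|z + s *: ax - x0| < Num.min r1 r2.
  move=> zr s0 sT; rewrite addrAC (le_lt_trans (ler_normD _ _))//.
  rewrite normrZ ger0_norm// -rC /C mulrDr mulr1 ltr_leD//.
  apply: (@le_trans _ _ (T * `|ax|)); first by rewrite ler_wpM2r.
  have -> : r * (2 * (M * `|ax|)) = M * (2 * r) * `|ax| by ring.
  by rewrite ler_wpM2r// ler_wpM2l// ltW.
have lift z : (Om `|` Gam) z -> `|z - x0| < r ->
    forall s, 0 < s -> s <= T -> Om (z + s *: ax).
  move=> Oz zr s s0 sT; have := near_lift _ _ zr (ltW s0) sT.
  rewrite lt_min => /andP[_ /inW Wz].
  apply/(graph_chart_height ch Wz); rewrite height_graph_axis//.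
  rewrite ltr_wpDl// height_ge0//; apply: inW.
  by have := near_lift _ _ zr (lexx _) (ltW T0); rewrite scale0r addr0 lt_min => /andP[].
pose x1 := x + T *: ax; pose y1 := y + T *: ax.
have Ox1 : Om x1 by apply: lift.
have Oy1 : Om y1 by apply: lift.
have x1r : `|x1 - x0| < r1.
  by have := near_lift _ _ xr (ltW T0) (lexx _); rewrite lt_min => /andP[].
have y1r : `|y1 - x0| < r1.
  by have := near_lift _ _ yr (ltW T0) (lexx _); rewrite lt_min => /andP[].
have rr1 z : `|z - x0| < r -> `|z - x0| < r1.
  move=> zr; have := near_lift _ _ zr (lexx _) (ltW T0).
  by rewrite scale0r addr0 lt_min => /andP[].
have up z : (Om `|` Gam) z -> `|z - x0| < r ->
    `|f (z + T *: ax) t0 - f z t0 - edot l (T *: ax)| <= e / C * (T * `|ax|).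
  move=> Oz zr.
  have E : z + T *: ax - z = T *: ax by rewrite addrC addKr.
  have := hr1 z (z + T *: ax); rewrite E normrZ (gtr0_norm T0); apply => //.
  - by left; exact: lift.
  - exact: rr1.
  - have := near_lift _ _ zr (ltW T0) (lexx _).
    by rewrite lt_min => /andP[].
  - move=> s s0 s1; rewrite scalerA; apply: lift => //; first by rewrite mulr_gt0.
    by rewrite ler_piMl// ltW.
have across : `|f y1 t0 - f x1 t0 - edot l (y - x)| <= e / C * D.
  have E : y1 - x1 = y - x by rewrite /y1 /x1 opprD addrACA subrr addr0.
  have := hr1 x1 y1; rewrite E; apply => //; [by left|by left|] => s s0 s1.
  rewrite /x1 addrAC.
  have zr : `|x + s *: (y - x) - x0| < r by apply: norm_segment_lt => //; exact: ltW.
  have := near_lift _ _ zr (ltW T0) (lexx _); rewrite lt_min => /andP[_ /inW Wz].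
  apply/(graph_chart_height ch Wz); rewrite height_graph_axis//.
  have Wx : W x.
    apply: inW; have := near_lift _ _ xr (lexx _) (ltW T0).
    by rewrite scale0r addr0 lt_min => /andP[].
  have hx := height_ge0 _ Ox Wx.
  have E' : x + s *: (y - x) - x = s *: (y - x) by rewrite addrC addKr.
  have := hH (x + s *: (y - x)) x; rewrite E' normrZ gtr0_norm//.
  rewrite ler_norml => /andP[+ _].
  have : H * (s * `|y - x|) < T.
    rewrite /T /M -/D; have : s * D < 1 * D by rewrite ltr_pM2r.
    rewrite mul1r mulrDl mul1r => h; apply: (@le_lt_trans _ _ (H * D)).
      by rewrite ler_wpM2l// ltW.
    by rewrite ltrDl.
  lra.
have ux := up _ Ox xr; have uy := up _ Oy yr.
have -> : f y t0 - f x t0 - edot l (y - x) =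
    (f y1 t0 - f x1 t0 - edot l (y - x))
    + (f x1 t0 - f x t0 - edot l (T *: ax))
    - (f y1 t0 - f y t0 - edot l (T *: ax)) by ring.
rewrite (le_trans (ler_normB _ _))//.
apply: (@le_trans _ _ (e / C * D + e / C * (T * `|ax|) + e / C * (T * `|ax|))).
  by rewrite lerD// (le_trans (ler_normD _ _))// lerD.
have -> : e / C * D + e / C * (T * `|ax|) + e / C * (T * `|ax|) =
    e / C * (1 + 2 * (M * `|ax|)) * D by rewrite /T; ring.
by rewrite -/C divfK ?gt_eqF.
Qed.

(** * The continuity equation on the boundary *)

(** A nonzero limit of the time derivative would bound the increments of p
    between two fixed times from below near x0, but they vanish on Gam. *)
Lemma C1_upto_time_derivative0 (R : realType) (d : nat)
    (Om Gam : set 'rV[R]_d) (I : set R) (p : 'rV[R]_d -> R -> R)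
    (x0 : 'rV[R]_d) (t0 : R) :
  closure Om x0 -> is_interval I -> I° !=set0 ->
  C1_upto Om Gam I p -> (forall x t, Gam x -> I t -> p x t = 0) ->
  Gam x0 -> I t0 ->
  derive1 (p z.1) z.2 @[z --> inner_nbhs Om I (x0, t0)] --> (0 : R).
Proof.
move=> clx iI I0 [U [oU GU /subspace_continuousP pc [pd pext] _]] p0 Gx0 It0.
have Ux0 : nbhs x0 U by apply: open_nbhs_nbhs; split=> //; exact: GU.
have hU := near_fst t0 Ux0.
have [a ca] := extends_continuously_cvg pext Ux0 Gx0 It0.
have B0 t : I t -> (((Om `&` U) `|` Gam) `*` I) (x0, t) by split; [right|].
suff -> : 0 = a by [].
apply/eqP; rewrite eq_sym; apply/negP => /negP a0.
have e0 : 0 < `|a| / 2 by rewrite divr_gt0// normr_gt0.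
have /cvgrPdist_le/(_ _ e0) := ca; rewrite near_withinE => ha.
have [r r0 rP] := (prod_ballP _ _).1 (filterI hU ha).
have proper_inner := inner_nbhs_proper clx iI I0 It0.
have [[xx t1] [[_ It1] /= t1r]] : exists z, (Om `*` I°) z /\ `|z.2 - t0| < r.
  apply: (@filter_ex _ (inner_nbhs Om I (x0, t0))).
  by apply/prod_ballP; exists r => // x t /= _ tr Oxt.
have [t2 t12 t2P] : exists2 t2, t1 < t2 & forall t, t1 <= t -> t <= t2 ->
    I° t /\ `|t - t0| < r.
  have : \forall t \near t1, I° t /\ `|t - t0| < r.
    apply: filterI.
      by apply: open_nbhs_nbhs; split => //; exact: open_interior.
    have : open_nbhs t1 (ball t0 r).
      by split; [exact: ball_open|rewrite /ball/= distrC].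
    by move/open_nbhs_nbhs; apply: filterS => t; rewrite /ball/= distrC.
  move=> /nbhs_ballP[q /= q0 qP]; exists (t1 + q / 2).
    by rewrite ltrDl divr_gt0.
  move=> t tt1 tt2; apply: qP; rewrite /ball/= distrC ger0_norm ?subr_ge0//.
  lra.
have t1' := t2P t1 (lexx _) (ltW t12); have t2' := t2P t2 (ltW t12) (lexx _).
have inc x : Om x -> `|x - x0| < r ->
    `|a| / 2 * (t2 - t1) <= `|p x t2 - p x t1|.
  move=> Omx xr.
  have dpx t : t \in `[t1, t2] -> is_derive t 1 (p x) (derive1 (p x) t).
    rewrite in_itv/= => /andP[tt1 tt2]; have [It tr] := t2P t tt1 tt2.
    have [Ux _] := rP x t xr tr.
    rewrite derive1E; apply: DeriveDef => //; exact: (pd (x, t)).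
  have [|c c12 ->] := @MVT_segment R (p x) (derive1 (p x)) t1 t2 (ltW t12)
      (fun s hs => dpx s (subset_itv_oo_cc hs)).
    by apply: derivable_within_continuous => s /dpx [].
  have : `|a - derive1 (p x) c| <= `|a| / 2.
    move: c12; rewrite in_itv/= => /andP[tt1 tt2].
    have [Ic cr] := t2P c tt1 tt2.
    by have [_] := rP x c xr cr; apply.
  have := ler_normB a (a - derive1 (p x) c); rewrite subKr => h1 h2.
  rewrite normrM (gtr0_norm (x := t2 - t1)) ?subr_gt0// ler_pM2r ?subr_gt0//.
  have := ler_normD (a - derive1 (p x) c) (derive1 (p x) c); rewrite subrK.
  lra.
have pcv t : I° t -> p x t @[x --> within Om (nbhs x0)] --> (0 : R).
  move=> It; have It' := interior_subset It.
  rewrite -(p0 _ _ Gx0 It').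
  apply: (@cvg_comp _ _ _ (fun x => (x, t)) (fun z => p z.1 z.2) _ _ _ _
    (pc _ (B0 _ It'))) => P /prod_ballP[q q0 qP].
  have : \forall x \near x0, `|x - x0| < q /\ U x.
    apply: filterI => //.
    apply/nbhs_ballP; exists q => // x.
    by rewrite ball_rV/= distrC.
  apply: filterS => x [xq Ux] Omx; apply: qP => //=; first by rewrite subrr normr0.
  by split => //=; left.
have pW : ProperFilter (within Om (nbhs x0)) by exact: within_nbhs_proper.
have cp : `|p x t2 - p x t1| @[x --> within Om (nbhs x0)] --> `|0 - 0 : R|.
  by apply: cvg_norm; exact: cvgB (pcv _ t2'.1) (pcv _ t1'.1).
have : `|a| / 2 * (t2 - t1) <= `|0 - 0 : R|.
  apply: (cvgr_to_ge cp); rewrite near_withinE.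
  apply/nbhs_ballP; exists r => // x; rewrite ball_rV/= distrC => xr Omx.
  exact: inc.
by rewrite subrr normr0 leNgt mulr_gt0 ?subr_gt0.
Unshelve. all: by end_near. Qed.

Lemma cvg_finite_sum (R : realType) (T : Type) (F : set_system T) (I : Type)
    (s : seq I) (f : I -> T -> R) (a : I -> R) : Filter F ->
  (forall i, f i z @[z --> F] --> a i) ->
  \sum_(i <- s) f i z @[z --> F] --> \sum_(i <- s) a i.
Proof.
move=> FF fa; elim: s => [|i s IH].
  by rewrite big_nil; under eq_fun do rewrite big_nil; exact: cvg_cst.
rewrite big_cons; under eq_fun do rewrite big_cons.
by apply: cvgD => //; exact: fa.
Qed.

(** The sum is the boundary value of the divergence, which the continuity
    equation makes the limit of the negated time derivative of p. *)
Lemma boundary_divergence0 (R : realType) (d : nat)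
    (Om Gam : set 'rV[R]_d) (I : set R) (p : 'rV[R]_d -> R -> R)
    (J : 'rV[R]_d -> R -> 'rV[R]_d) (x0 : 'rV[R]_d) (t0 : R)
    (l : 'I_d -> 'rV[R]_d) :
  closure Om x0 -> is_interval I -> I° !=set0 ->
  C1_upto Om Gam I p -> (forall x t, Gam x -> I t -> p x t = 0) ->
  (\forall x \near x0, Om x -> forall t : R, I° t ->
     derive1 (p x) t + divergence (J ^~ t) x = 0) ->
  Gam x0 -> I t0 ->
  (forall j i : 'I_d, partial_deriv i (fun x => J x z.2 0 j) z.1
     @[z --> inner_nbhs Om I (x0, t0)] --> l j 0 i) ->
  \sum_i l i 0 i = 0.
Proof.
move=> clx iI I0 pC1 p0 ce Gx0 It0 Jl.
have proper_inner := inner_nbhs_proper clx iI I0 It0.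
have cp := C1_upto_time_derivative0 clx iI I0 pC1 p0 Gx0 It0.
have cd : divergence (J ^~ z.2) z.1 @[z --> inner_nbhs Om I (x0, t0)]
    --> \sum_i l i 0 i.
  exact: (@cvg_finite_sum _ _ _ _ (index_enum 'I_d)
    (fun i z => partial_deriv i (fun x => J x z.2 0 i) z.1)
    (fun i => l i 0 i) _ (fun i => Jl i i)).
have c1 : derive1 (p z.1) z.2 + divergence (J ^~ z.2) z.1
    @[z --> inner_nbhs Om I (x0, t0)] --> \sum_i l i 0 i.
  by rewrite -[X in _ --> X]add0r; exact: cvgD cp cd.
have c0 : derive1 (p z.1) z.2 + divergence (J ^~ z.2) z.1
    @[z --> inner_nbhs Om I (x0, t0)] --> (0 : R).
  apply: cvg_near_cst; have /nbhs_ballP[r /= r0 rP] := ce.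
  apply/prod_ballP; exists r => // x t /= xr _ [Omx It].
  by apply: rP => //; rewrite ball_rV/= distrC.
exact: (cvg_unique _ c1 c0).
Qed.

(** * Gradients of functions vanishing on the patch *)

(** F vanishes along the curve that the i-th coordinate line of the base draws
    on the graph; the difference quotients of this curve tend to tau. *)
Lemma tangential_derivative0 (R : realType) (d : nat) (Om Gam V : set 'rV[R]_d)
    (F : 'rV[R]_d -> R) (x0 l : 'rV[R]_d) (W : set 'rV[R]_d) (Q : 'M[R]_d)
    (k : 'I_d) (gam : 'rV[R]_d.-1 -> R) (i : 'I_d.-1) :
  open Om -> open V -> Gam = topo_boundary Om `&` V -> Gam x0 ->
  graph_chart Om x0 W Q k gam -> (forall z, differentiable gam z) ->
  (forall e, 0 < e -> \forall x \near x0, Gam x ->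
     `|F x - F x0 - edot l (x - x0)| <= e * `|x - x0|) ->
  (\forall x \near x0, Gam x -> F x = 0) ->
  (l *m Q) 0 (lift k i) =
    - (partial_deriv i gam (col' k (x0 *m Q)) * (l *m Q) 0 k).
Proof.
move=> oOm oV GE Gx0 ch dgam Fl F0; have [oW Wx0 QQ _] := ch.
have QQ' := mulmx1C QQ.
have cgam : continuous gam by move=> z; exact: differentiable_continuous.
have hc := @height_continuous _ _ Q k _ cgam.
have [Bx0 Vx0] : (topo_boundary Om `&` V) x0 by rewrite -GE.
have h0 := boundary_height0 oOm ch hc Bx0 Wx0.
pose z' := col' k (x0 *m Q); pose di : 'rV[R]_d.-1 := delta_mx 0 i.
(* for s != 0, y s is the point of the graph above z' + s *: di *)
pose D (s : R) := s^-1 *: (gam (s *: di + z') - gam z').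
pose A : 'rV[R]_d := delta_mx 0 (lift k i) *m Q^T; pose ax := graph_axis Q k.
pose q s := A + D s *: ax; pose y s := x0 + s *: q s.
pose tau := A + partial_deriv i gam z' *: ax.
have cD : D s @[s --> (0 : R)^'] --> partial_deriv i gam z'.
  by apply: (@diff_derivable _ _ _ gam z' di).
have cq : q s @[s --> (0 : R)^'] --> tau.
  by apply: cvgD; [exact: cvg_cst|apply: cvgZr_tmp].
have cs : s @[s --> (0 : R)^'] --> (0 : R) by exact: cvg_within.
have cy : y s @[s --> (0 : R)^'] --> x0.
  rewrite -[X in _ --> X]addr0 -(scale0r tau); apply: cvgD; first exact: cvg_cst.
  exact: cvgZ cs cq.
have yQ s : y s *m Q = x0 *m Q + s *: delta_mx 0 (lift k i) + (s * D s) *: delta_mx 0 k.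
  rewrite /y /q scalerDr scalerA addrA graph_axisQ//; congr (_ + _).
  by rewrite mulmxDl -scalemxAl -mulmxA QQ' mulmx1.
have colE s : col' k (y s *m Q) = s *: di + z'.
  rewrite yQ !linearD/= !linearZ/= col'_delta scaler0 addr0 addrC; congr (_ *: _ + _).
  by apply/rowP => j; rewrite !mxE !eqxx/= (inj_eq lift_inj).
have hy s : s != 0 -> height Q k gam (y s) = 0.
  move=> s0; rewrite /height colE yQ.
  have -> : (x0 *m Q + s *: delta_mx 0 (lift k i) + (s * D s) *: delta_mx 0 k) 0 k =
      (x0 *m Q) 0 k + s * D s.
    move: (x0 *m Q) (s * D s) => z w; rewrite !mxE !eqxx/=.
    by rewrite (negbTE (neq_lift k i)) mulr0 addr0 mulr1.
  rewrite /D mulrA divff// mul1r.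
  by move: h0; rewrite /height -/z'; lra.
have Gy : \forall s \near (0 : R)^', Gam (y s).
  have WV : nbhs x0 (W `&` V) by apply: filterI; exact: open_nbhs_nbhs.
  near=> s; have s0 : s != 0 by near: s; exact: nbhs_dnbhs_neq.
  have [Wy Vy] : (W `&` V) (y s) by near: s; exact: (cy _ WV).
  by rewrite GE; split => //; exact: (height0_boundary oOm ch Wy (hy _ s0)).
have tau0 : edot l tau = 0.
  apply/eqP; rewrite -normr_le0; apply/ler_addgt0Pl => e e0; rewrite addr0.
  have t0 : 0 < `|tau| + 1 by rewrite ltr_wpDl.
  have e1 : 0 < e / (`|tau| + 1) by rewrite divr_gt0.
  apply: (@le_trans _ _ (e / (`|tau| + 1) * `|tau|)); last first.
    by rewrite mulrAC -mulrA ger_pMr// ler_pdivrMr// mul1r lerDl.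
  have cL : `|edot l (q s)| @[s --> (0 : R)^'] --> `|edot l tau|.
    apply: cvg_norm; apply: (@cvg_comp _ _ _ _ (edot l) _ _ _ cq).
    exact: edot_continuous.
  have cR : e / (`|tau| + 1) * `|q s| @[s --> (0 : R)^'] -->
      e / (`|tau| + 1) * `|tau|.
    by apply: cvgMr; exact: cvg_norm.
  have nF : \forall s \near (0 : R)^', Gam (y s) ->
      `|F (y s) - F x0 - edot l (y s - x0)| <= e / (`|tau| + 1) * `|y s - x0|.
    exact: (cy _ (Fl _ e1)).
  have nF0 : \forall s \near (0 : R)^', Gam (y s) -> F (y s) = 0.
    exact: (cy _ F0).
  apply: (ler_cvg_to cL cR); near=> s.
  have s0 : s != 0 by near: s; exact: nbhs_dnbhs_neq.
  have Gs : Gam (y s) by near: s.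
  have Fs : F (y s) = 0 by move: Gs; near: s.
  have Fx0 : F x0 = 0 by exact: (nbhs_singleton F0).
  have : `|F (y s) - F x0 - edot l (y s - x0)| <= e / (`|tau| + 1) * `|y s - x0|.
    by move: Gs; near: s.
  have -> : y s - x0 = s *: q s by rewrite /y addrC addKr.
  rewrite Fs Fx0 subrr sub0r normrN edotZr normrM normrZ mulrCA.
  by rewrite ler_pM2l// normr_gt0.
move: tau0; rewrite /tau edotDr edotZr !edot_mulmx_tr !edot_delta.
by move/eqP; rewrite addr_eq0 => /eqP.
Unshelve. all: by end_near. Qed.

(** The vector that [chart_normal] normalizes, in the rotated coordinates *)
Definition chart_conormal (R : realType) (d : nat) (Q : 'M[R]_d) (k : 'I_d)
    (gam : 'rV[R]_d.-1 -> R) (y : 'rV[R]_d) : 'rV[R]_d :=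
  \row_j (if unlift k j is Some i then partial_deriv i gam (col' k (y *m Q))
          else -1).

(** The tangent vectors tau_i of the graph and the graph axis span the space,
    so a gradient orthogonal to every tau_i is determined by its component
    along the axis. *)
Lemma gradient_normal (R : realType) (d : nat) (Om Gam V : set 'rV[R]_d)
    (F : 'rV[R]_d -> R) (x0 l : 'rV[R]_d) (W : set 'rV[R]_d) (Q : 'M[R]_d)
    (k : 'I_d) (gam : 'rV[R]_d.-1 -> R) :
  open Om -> open V -> Gam = topo_boundary Om `&` V -> Gam x0 ->
  graph_chart Om x0 W Q k gam -> (forall z, differentiable gam z) ->
  (forall e, 0 < e -> \forall x \near x0, Gam x ->
     `|F x - F x0 - edot l (x - x0)| <= e * `|x - x0|) ->
  (\forall x \near x0, Gam x -> F x = 0) ->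
  exists b, l = b *: chart_normal Q k gam x0.
Proof.
move=> oOm oV GE Gx0 ch dgam Fl F0; have [_ _ QQ _] := ch.
have T i := tangential_derivative0 i oOm oV GE Gx0 ch dgam Fl F0.
pose N := chart_conormal Q k gam x0.
have N0 : enorm N != 0.
  rewrite gt_eqF// (lt_le_trans _ (norm_le_enorm _))//.
  rewrite (lt_le_trans _ (coord_le_norm _ k))// mxE unlift_none normrN1.
  exact: ltr01.
exists (- (l *m Q) 0 k * enorm N).
rewrite /chart_normal -/(chart_conormal Q k gam x0) -/N scalerA mulfK//.
have lE : (l *m Q) *m Q^T = l by rewrite -mulmxA QQ mulmx1.
rewrite -[LHS]lE scalemxAl; congr (_ *m _).
apply/rowP => j; rewrite [in RHS]mxE [N _ _]mxE; case: unliftP => [i ->|->].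
  by rewrite T mulrC mulNr mulrC.
by rewrite mulrN1 opprK.
Qed.

(** * Failure of integrability *)

(** A closed ball of the sup norm, in the form of a product of intervals *)
Definition tuple_cube (R : realType) (d : nat) (x : 'rV[R]_d) (r : R) :
    set (d.-tuple (measurableTypeR R)) :=
  [set t | forall i, `[x 0 i - r, x 0 i + r]%classic (tnth t i)].

Lemma tuple_cubeP (R : realType) (d : nat) (x : 'rV[R]_d) (r : R)
    (t : d.-tuple (measurableTypeR R)) : 0 <= r ->
  tuple_cube x r t <-> `|row_of_tuple t - x| <= r.
Proof.
move=> r0; split=> [xt|xt i].
  apply: rV_norm_le => // i; rewrite !mxE ler_distl.
  by have := xt i; rewrite /= in_itv/=.
rewrite /= in_itv/= -ler_distl.
by have := coordB_le_norm (row_of_tuple t) x i; rewrite mxE => /le_trans; apply.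
Qed.

Lemma measurable_tuple_cube (R : realType) (d : nat) (x : 'rV[R]_d) (r : R) :
  measurable (tuple_cube x r).
Proof.
rewrite (_ : tuple_cube x r = \bigcap_(i in [set: 'I_d])
    ((fun t => tnth t i) @^-1` `[x 0 i - r, x 0 i + r]%classic)).
  apply: fin_bigcap_measurable => // i _.
  rewrite -[X in measurable X]setTI.
  apply: (measurable_tnth i) => //; exact: measurable_itv.
by apply/seteqP; split => t /= h i => [_|]; exact: h.
Qed.

Lemma lebesgue_tuple_cube (R : realType) (d : nat) (x : 'rV[R]_d) (r : R) :
  0 < r -> lebesgue_tuple R d (tuple_cube x r) = ((2 * r) ^+ d)%:E.
Proof.
move=> r0; have -> := @tuple_measure_box _ _ R (@lebesgue_measure R) d
  (fun i => `[x 0 i - r, x 0 i + r]%classic) (fun=> measurable_itv _).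
rewrite (eq_bigr (fun=> (2 * r)%:E)) => [|i _].
  by rewrite prodEFin prodr_const card_ord.
apply: (etrans (lebesgue_measure_itv `[x 0 i - r, x 0 i + r])).
rewrite /= lte_fin ltrD2l gtrN//= -EFinD.
by congr EFin; ring.
Qed.

(** Rational cubes form a countable base of the topology. *)
Lemma measurable_row_of_tuple_open (R : realType) (d : nat)
    (O : set 'rV[R]_d) :
  open O -> measurable (@row_of_tuple R d @^-1` O).
Proof.
move=> oO; pose T := ('rV[rat]_d * nat)%type.
pose B (q : T) := tuple_cube (map_mx (@ratr R) q.1) (q.2.+1%:R^-1).
pose F n := if unpickle n is Some q then
  (if `[< B q `<=` @row_of_tuple R d @^-1` O >] then B q else set0) else set0.
rewrite (_ : _ @^-1` _ = \bigcup_n F n).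
  apply: bigcupT_measurable => n; rewrite /F; case: unpickle => [q|//].
  by case: ifP => _ //; exact: measurable_tuple_cube.
apply/seteqP; split=> [t /= Ot|t [n _]]; last first.
  by rewrite /F; case: unpickle => // q; case: ifPn => // /asboolP; exact.
have /nbhs_ballP[r /= r0 rO] : nbhs (row_of_tuple t) O by exact: open_nbhs_nbhs.
have [n nr] : exists n : nat, n.+1%:R^-1 < r / 2.
  exists (Num.trunc (r / 2)^-1); rewrite invf_plt ?posrE ?divr_gt0//.
  exact: truncnS_gt.
have n0 : 0 < n.+1%:R^-1 :> R by rewrite invr_gt0.
have qP (i : 'I_d) : exists q : rat,
    ratr q \in `](tnth t i : R) - n.+1%:R^-1, (tnth t i : R) + n.+1%:R^-1[.
  by apply: rat_in_itvoo; rewrite ltrD2l gtrN.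
have [q {}qP] := choice qP.
pose q' : T := (\row_i q i, n).
exists (pickle q') => //; rewrite /F pickleK.
have BO : B q' `<=` @row_of_tuple R d @^-1` O.
  move=> u /(tuple_cubeP _ _ (ltW n0)) /= uq; apply: rO; rewrite ball_rV/=.
  have tq : `|row_of_tuple t - map_mx ratr (\row_i q i)| <= n.+1%:R^-1.
    apply: rV_norm_le => [|i]; first exact: ltW.
    rewrite !mxE distrC ler_distl; have := qP i.
    by rewrite in_itv/= => /andP[/ltW -> /ltW ->].
  rewrite -(subrKA (map_mx ratr (\row_i q i))).
  rewrite (le_lt_trans (ler_normD _ _))// [`|_ - row_of_tuple u|]distrC.
  by apply: le_lt_trans (lerD tq uq) _; rewrite [ltRHS]splitr ltrD.
rewrite asboolT//; apply/tuple_cubeP; first exact: ltW.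
apply: rV_norm_le => [|i]; first exact: ltW.
rewrite !mxE distrC ler_distl; have := qP i.
by rewrite in_itv/= => /andP[/ltW -> /ltW ->].
Qed.

(** For an integrable function the integrals over the E n would tend to 0 by
    dominated convergence. *)
Lemma vanishing_sets_not_integrable (disp : measure_display)
    (T : measurableType disp) (R : realType) (mu : {measure set T -> \bar R})
    (D : set T) (g : T -> R) (E : nat -> set T) (a : nat -> R) (kappa : R) :
  measurable D -> (forall n, measurable (E n)) -> (forall n, E n `<=` D) ->
  (forall t, \forall n \near \oo, ~ E n t) ->
  (forall n, {ae mu, forall t, E n t -> a n <= `|g t|}) ->
  (forall n, 0 <= a n) -> 0 < kappa ->
  (forall n, (kappa%:E <= (a n)%:E * mu (E n))%E) ->
  ~ mu.-integrable D (EFin \o g).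
Proof.
move=> mD mE ED E0 Ea a0 kappa0 kE ig.
pose G := abse \o (EFin \o g).
have iG : mu.-integrable D G by exact: integrable_abse.
have mG : measurable_fun D G by exact: measurable_int iG.
have mGE n : measurable_fun D (G \_ (E n)).
  apply/(measurable_restrict _ (mE n) mD); apply: measurable_funS mG => //.
have c0 x : D x -> (fun n => (G \_ (E n)) x) @ \oo --> (0 : \bar R)%E.
  move=> Dx; apply: cvg_near_cst; apply: filterS (E0 x) => n nE.
  by rewrite patchE; case: ifPn => // /set_mem.
have fin x : D x -> G x \is a fin_num by [].
have dom n x : D x -> (`|(G \_ (E n)) x| <= G x)%E.
  move=> Dx; rewrite patchE; case: ifPn => _ /=; first by rewrite normr_id.
  by rewrite normr0 lee_fin.
have := @dominated_cvg _ _ _ mu D mD (fun n => G \_ (E n)) (cst 0%E) G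
  mGE c0 fin iG dom.
have ge n : (kappa%:E <= \int[mu]_(x in D) (G \_ (E n)) x)%E.
  rewrite -integral_mkcondr (setIidr (ED n)).
  apply: le_trans (kE n) _; rewrite -integral_cst//.
  apply: ae_ge0_le_integral => //.
  - by move=> x _; rewrite lee_fin.
  - by move=> x _; rewrite /G /= lee_fin.
  - exact: measurable_funS mD (ED n) mG.
rewrite integral_cst// mul0e => cI.
have : (kappa%:E <= 0)%E.
  by apply: (cvge_to_ge cI); exact: nearW.
by rewrite lee_fin leNgt kappa0.
Qed.

Lemma vanishing_sets_not_L1_on (R : realType) (d : nat) (A : set 'rV[R]_d)
    (f : 'rV[R]_d -> R) (E : nat -> set (d.-tuple (measurableTypeR R)))
    (a : nat -> R) (kappa : R) :
  open A -> (forall n, measurable (E n)) ->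
  (forall n, E n `<=` @row_of_tuple R d @^-1` A) ->
  (forall t, \forall n \near \oo, ~ E n t) ->
  (forall n t, E n t -> a n <= `|f (row_of_tuple t)|) ->
  (forall n, 0 <= a n) -> 0 < kappa ->
  (forall n, (kappa%:E <= (a n)%:E * lebesgue_tuple R d (E n))%E) ->
  ~ L1_on A f.
Proof.
move=> oA mE EA E0 Ea a0 kappa0 kE [g ig fg].
apply: (vanishing_sets_not_integrable (measurable_row_of_tuple_open oA) mE EA
  E0 _ a0 kappa0 kE ig) => n.
by apply: filterS fg => t ft Et; rewrite -ft; [exact: Ea|exact: EA Et].
Qed.

Lemma norm_insert_coord_le (R : realType) (d : nat) (k : 'I_d)
    (z : 'rV[R]_d.-1) (h : R) : `|insert_coord k z h| <= `|z| + `|h|.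
Proof.
apply: rV_norm_le => [|j]; first by rewrite addr_ge0.
rewrite mxE; case: unliftP => [i _|_]; last by rewrite lerDr.
by rewrite (le_trans (coord_le_norm z i))// lerDl.
Qed.

Lemma insert_coordB (R : realType) (d : nat) (k : 'I_d)
    (z z' : 'rV[R]_d.-1) (h h' : R) :
  insert_coord k z h - insert_coord k z' h' = insert_coord k (z - z') (h - h').
Proof. by apply/rowP => j; rewrite !mxE; case: unliftP => [i|] _; rewrite ?mxE. Qed.

(** At scale 1/(n+1), (n+1)^(d-1) disjoint cubes of side comparable to
    1/(n+1) fit between the graph and its translate by a multiple of 1/(n+1):
    one above each point of a grid in the hyperplane of the graph. *)
Lemma boundary_layers (R : realType) (d : nat) (y0 : 'rV[R]_d)
    (Q : 'M[R]_d) (k : 'I_d) (gam : 'rV[R]_d.-1 -> R) (delta : R) :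
  Q *m Q^T = 1%:M -> lipschitz gam -> height Q k gam y0 = 0 -> 0 < delta ->
  exists (E : nat -> set (d.-tuple (measurableTypeR R))) (C kappa : R),
  [/\ 0 < C, 0 < kappa, forall n, measurable (E n),
      forall n t, E n t -> [/\ `|row_of_tuple t - y0| < delta,
        0 < height Q k gam (row_of_tuple t) &
        height Q k gam (row_of_tuple t) <= C / n.+1%:R] &
      forall n, lebesgue_tuple R d (E n) = (kappa / n.+1%:R)%:E].
Proof.
move=> QQ lgam hy0 delta0; have QQ' := mulmx1C QQ.
have [H H0 hH] := height_lipschitz Q k lgam.
have [L L0 gL] := lipschitz_bound lgam.
have [K1 K11 QK] := mulmx_norm_le Q; have [K2 K21 QTK] := mulmx_norm_le Q^T.
have K10 : 0 < K1 by rewrite (lt_le_trans _ K11).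
have K20 : 0 < K2 by rewrite (lt_le_trans _ K21).
(* the height varies by at most H * h n on a cube of radius at most h n, so the
   cubes centred at height M * h n lie strictly above the graph *)
pose M := H + 1; have M0 : 0 < M by rewrite ltr_wpDl.
pose B := K2 * (1 + L + M) + 1.
have B0 : 0 < B by rewrite ltr_wpDl// mulr_ge0 ?addr_ge0// ltW.
pose r := delta / (2 * B); have r0 : 0 < r by rewrite divr_gt0// mulr_gt0.
pose h n : R := r / n.+1%:R; have h0 n : 0 < h n by rewrite divr_gt0.
have hr n : h n <= r by rewrite ler_pdivrMr// ler_peMr ?ler1n// ltW.
(* the rotation Q enlarges a cube by at most the factor K1, so distinct cubes of
   this radius project into disjoint cells of the grid of mesh h n *)
pose rho n := h n / (4 * K1); have rho0 n : 0 < rho n.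
  by apply: divr_gt0; [exact: h0|exact: mulr_gt0].
have rhoK n : K1 * rho n = h n / 4.
  by rewrite /rho; field; rewrite gt_eqF.
have rhoh n : rho n <= h n.
  rewrite ler_pdivrMr ?mulr_gt0//; apply: ler_peMr; [exact: ltW|lra].
pose T n := {ffun 'I_d.-1 -> 'I_n.+1}.
pose z0 := col' k (y0 *m Q).
have z0k : (y0 *m Q) 0 k = gam z0 by move: hy0; rewrite /height -/z0; lra.
pose z n (m : T n) : 'rV[R]_d.-1 := z0 + h n *: \row_i (m i)%:R.
pose w n (m : T n) := insert_coord k (z n m) (gam (z n m) + M * h n).
pose x n (m : T n) := w n m *m Q^T.
have xQ n m : x n m *m Q = w n m by rewrite -mulmxA QQ' mulmx1.
have hx n m : height Q k gam (x n m) = M * h n.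
  by rewrite /height xQ col'_insert_coord insert_coord_k addrC addKr.
have zr n m : `|z n m - z0| <= r.
  rewrite /z addrC addKr normrZ (gtr0_norm (h0 n)).
  apply: (@le_trans _ _ (h n * n.+1%:R)); last by rewrite divfK.
  rewrite ler_wpM2l//; first exact: ltW.
  apply: rV_norm_le => // i; rewrite mxE ger0_norm// ler_nat.
  exact: ltnW.
have xr n m : `|x n m - y0| <= K2 * (1 + L + M) * r.
  have -> : x n m - y0 = (w n m - y0 *m Q) *m Q^T.
    by rewrite mulmxBl -(mulmxA y0) QQ mulmx1.
  rewrite (le_trans (QTK _))// -mulrA ler_pM2l//.
  rewrite -(insert_coordK k (y0 *m Q)) insert_coordB -/z0 z0k.
  rewrite (le_trans (norm_insert_coord_le _ _ _))//.
  have -> : gam (z n m) + M * h n - gam z0 = gam (z n m) - gam z0 + M * h n by ring.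
  have := ler_normD (gam (z n m) - gam z0) (M * h n).
  have := gL (z n m) z0.
  have := zr n m.
  have : L * `|z n m - z0| <= L * r by rewrite ler_wpM2l.
  have : M * h n <= M * r by rewrite ler_wpM2l// ltW.
  rewrite (gtr0_norm (mulr_gt0 M0 (h0 n))) => b1 b2 b3 b4 b5; lra.
pose E n := \bigcup_(m in [set` enum (T n)]) tuple_cube (x n m) (rho n).
exists E, (2 * M * r), ((r / (2 * K1)) ^+ d).
have inE n t : E n t -> exists m, `|row_of_tuple t - x n m| <= rho n.
  by move=> [m _ /(tuple_cubeP _ _ (ltW (rho0 n)))]; exists m.
split.
- by apply: mulr_gt0 => //; exact: mulr_gt0.
- by apply: exprn_gt0; apply: divr_gt0 => //; exact: mulr_gt0.
- move=> n; apply: fin_bigcup_measurable; first exact: finite_seq.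
  by move=> m _; exact: measurable_tuple_cube.
- move=> n t /inE[m tm]; have := hH (row_of_tuple t) (x n m).
  have h1 : H * `|row_of_tuple t - x n m| <= H * h n.
    by rewrite ler_wpM2l// (le_trans tm).
  have h2 : M * h n = H * h n + h n by rewrite mulrDl mul1r.
  rewrite hx ler_norml => /andP[a1 a2]; have hn0 := h0 n; split.
  + rewrite -(subrKA (x n m)) (le_lt_trans (ler_normD _ _))//.
    apply: (@le_lt_trans _ _ (r + K2 * (1 + L + M) * r)).
      by rewrite lerD// (le_trans tm)// (le_trans (rhoh n)).
    have -> : r + K2 * (1 + L + M) * r = delta / 2.
      have -> : r + K2 * (1 + L + M) * r = B * r by rewrite /B; ring.
      by rewrite /r; field; rewrite gt_eqF.
    by rewrite ltr_pdivrMr// ltr_pMr// ltrDl.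
  + lra.
  + by rewrite -mulrA -/(h n); lra.
- move=> n; rewrite /E measure_fin_bigcup; last 1 first.
  + by move=> m _; exact: measurable_tuple_cube.
  + rewrite -fsbig_seq ?enum_uniq//.
    rewrite (eq_bigr (fun=> ((2 * rho n) ^+ d)%:E)) => [|m _]; last first.
      exact: lebesgue_tuple_cube.
    rewrite sumEFin big_enum/= sumr_const card_ffun !card_ord.
    congr EFin; rewrite -[LHS]mulr_natl natrX.
    have -> : 2 * rho n = r / (2 * K1) / n.+1%:R.
      by rewrite /rho /h; field; rewrite nat1r pnatr_eq0 (gt_eqF K10).
    have d_gt0 : (0 < d)%N by rewrite (leq_trans _ (ltn_ord k)).
    rewrite expr_div_n -[in X in _ / X](prednK d_gt0) exprS.
    by field; rewrite nat1r pnatr_eq0 expf_neq0// pnatr_eq0.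
  + exact: finite_seq.
  + move=> m m' _ _ [t []].
    move=> /(tuple_cubeP _ _ (ltW (rho0 n))) tm.
    move=> /(tuple_cubeP _ _ (ltW (rho0 n))) tm'.
    apply/ffunP => i; apply/val_inj/eqP.
    have wm (u : T n) : `|row_of_tuple t - x n u| <= rho n ->
        `|row_of_tuple t *m Q - w n u| <= h n / 4.
      move=> tu; rewrite -xQ -mulmxBl (le_trans (QK _))// -rhoK.
      by rewrite ler_wpM2l// ltW.
    have zz : `|z n m - z n m'| <= h n / 2.
      rewrite -(col'_insert_coord k (z n m) (gam (z n m) + M * h n)).
      rewrite -(col'_insert_coord k (z n m') (gam (z n m') + M * h n)).
      rewrite -linearB/= (le_trans (norm_col'_le _ _))//.
      rewrite -(subrKA (row_of_tuple t *m Q)) (le_trans (ler_normD _ _))//.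
      rewrite [`|_ - row_of_tuple t *m Q|]distrC.
      by apply: le_trans (lerD (wm _ tm) (wm _ tm')) _; lra.
    have := le_trans (coordB_le_norm _ _ i) zz; rewrite !mxE.
    rewrite opprD addrACA subrr add0r -mulrBr normrM (gtr0_norm (h0 n)).
    rewrite (ler_pM2l (h0 n)) => mm.
    have le_of (a b : nat) : a%:R - b%:R <= 2^-1 :> R -> (a <= b)%N.
      move=> ab; rewrite leqNgt; apply/negP; rewrite -(ler_nat R) -natr1; lra.
    move: mm; rewrite ler_norml => /andP[m1 m2].
    by rewrite eqn_leq !le_of//; lra.
Qed.

(** The form in which strict differentiability enters the comparison of J with
    its boundary value and of p with the distance to Gam *)
Definition lipschitz_near (R : realType) (d : nat) (A : set 'rV[R]_d)
    (f : 'rV[R]_d -> R) (x0 : 'rV[R]_d) : Prop :=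
  exists C r : R, [/\ 0 <= C, 0 < r & forall x y, A x -> A y ->
    `|x - x0| < r -> `|y - x0| < r -> `|f y - f x| <= C * `|y - x|].

Lemma C1_upto_lipschitz_near (R : realType) (d : nat) (Om Gam : set 'rV[R]_d)
    (I : set R) (f : 'rV[R]_d -> R -> R) (x0 : 'rV[R]_d) (t0 : R) :
  Lipschitz_domain Om -> Gam `<=` topo_boundary Om ->
  is_interval I -> I° !=set0 ->
  C1_upto Om Gam I f -> Gam x0 -> I t0 ->
  lipschitz_near (Om `|` Gam) (f ^~ t0) x0.
Proof.
move=> [oOm _ lOm] GO iI I0 fC1 Gx0 It0.
have [W [Q [k [gam [ch lgam]]]]] := lOm _ (GO _ Gx0).
have [l fl] := C1_upto_partials fC1 Gx0 It0.
have [r r0 rP] := C1_upto_strict oOm GO ch lgam iI I0 fC1 Gx0 It0 fl ltr01.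
exists (1 + d%:R * `|l|), r; split=> // x y Ax Ay xr yr.
have := rP _ _ Ax Ay xr yr; have := norm_edot_le l (y - x).
have := ler_normD (f y t0 - f x t0 - edot l (y - x)) (edot l (y - x)).
by rewrite subrK mulrDl; lra.
Qed.

(** Near a boundary point where F does not vanish, F / P is at least of the
    order of 1 / dist, whereas the layer at distance about 1 / (n + 1) has
    measure about 1 / (n + 1). *)
Lemma quotient_not_L1_on (R : realType) (d : nat) (Om Gam V N : set 'rV[R]_d)
    (F P : 'rV[R]_d -> R) (y0 : 'rV[R]_d) :
  Lipschitz_domain Om -> open V -> Gam = topo_boundary Om `&` V -> Gam y0 ->
  open N -> N y0 ->
  lipschitz_near (Om `|` Gam) F y0 -> lipschitz_near (Om `|` Gam) P y0 ->
  (forall y, Gam y -> P y = 0) ->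
  (\forall x \near y0, Om x -> 0 < P x) ->
  F y0 != 0 ->
  ~ L1_on (Om `&` N) (fun x => (P x)^-1 * F x).
Proof.
move=> [oOm _ lOm] oV GE Gy0 oN Ny0 [CF [rF [CF0 rF0 FL]]].
move=> [CP [rP [CP0 rP0 PL]]] P0 Pgt0 Fy0.
have [By0 Vy0] : (topo_boundary Om `&` V) y0 by rewrite -GE.
have [W [Q [k [gam [ch lgam]]]]] := lOm _ By0.
have [oW Wy0 QQ _] := ch.
have [H H0 hH] := height_lipschitz Q k lgam.
have hc : continuous (height Q k gam) by exact: bounded_increment_continuous hH.
have hy0 := boundary_height0 oOm ch hc By0 Wy0.
pose ax := graph_axis Q k; pose b := `|F y0| / 2.
have b0 : 0 < b by rewrite divr_gt0// normr_gt0.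
have good : \forall x \near y0, [/\ W x, V x, N x & Om x -> 0 < P x].
  have near_open (O : set 'rV[R]_d) : open O -> O y0 -> nbhs y0 O.
    by move=> oO Oy; exact: open_nbhs_nbhs.
  near=> x; split.
  - by near: x; exact: near_open.
  - by near: x; exact: near_open.
  - by near: x; exact: near_open.
  - by near: x.
have /nbhs_ballP[r1 /= r10 r1P] := good.
have CF1 : 0 < CF + 1 by rewrite ltr_wpDl.
pose rho := Num.min (Num.min r1 (b / (CF + 1))) (Num.min rF rP).
have rho0 : 0 < rho by rewrite !lt_min r10 rF0 rP0 divr_gt0.
have rhoP x : `|x - y0| < rho -> [/\ W x /\ V x, N x, Om x -> 0 < P x,
    `|x - y0| < b / (CF + 1) & `|x - y0| < rF /\ `|x - y0| < rP].
  rewrite !lt_min => /andP[/andP[x1 x2] /andP[x3 x4]].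
  by have /r1P[] : ball y0 r1 x by rewrite ball_rV/= distrC.
have Hax : 0 < 1 + H * `|ax| by rewrite ltr_pwDl// mulr_ge0.
(* if x is this close to y0, its projection to the graph is within rho of y0 *)
have delta0 : 0 < rho / (1 + H * `|ax|) by rewrite divr_gt0.
have [E [C [kappa [C0 kappa0 mE EP muE]]]] :=
  boundary_layers QQ lgam hy0 delta0.
have [A AE A0] : exists2 A : R, A = CP * `|ax| * C + 1 & 0 < A.
  by eexists => //; rewrite ltr_wpDl// !mulr_ge0// ltW.
have main n t : E n t -> [/\ Om (row_of_tuple t), N (row_of_tuple t) &
    b / A * n.+1%:R <=
      `|(P (row_of_tuple t))^-1 * F (row_of_tuple t)|].
  move=> /EP; move: (row_of_tuple t) => x [xd hx0 hxC].
  have xr : `|x - y0| < rho.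
    by rewrite (lt_le_trans xd)// ler_pdivrMr// ler_peMr ?lerDl ?mulr_ge0// ltW.
  have [[Wx Vx] Nx Px xb [xF xP]] := rhoP _ xr.
  have Ox : Om x by apply/(graph_chart_height ch Wx).
  (* the point of Gam below x along the axis *)
  pose y := x - height Q k gam x *: ax.
  have hy : height Q k gam y = 0.
    by rewrite /y -scaleNr height_graph_axis// subrr.
  have yr : `|y - y0| < rho.
    rewrite /y addrAC (le_lt_trans (ler_normB _ _))// normrZ (gtr0_norm hx0).
    have := hH x y0; rewrite hy0 subr0 (gtr0_norm hx0) => hxH.
    move: xd; rewrite ltr_pdivlMr//; apply: le_lt_trans.
    by rewrite mulrDr mulr1 lerD2l mulrCA mulrA ler_wpM2r.
  have [[Wy Vy] _ _ _ [_ yP]] := rhoP _ yr.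
  have Gy : Gam y by rewrite GE; split => //; exact: (height0_boundary oOm ch Wy hy).
  have PxC : P x <= A / n.+1%:R.
    have := PL _ _ (or_intror Gy) (or_introl Ox) yP xP; rewrite (P0 _ Gy) subr0.
    move=> /(le_trans (ler_norm _)); move/le_trans; apply.
    rewrite /y subKr normrZ (gtr0_norm hx0).
    apply: (@le_trans _ _ (CP * (C / n.+1%:R * `|ax|))).
      by rewrite ler_wpM2l// ler_wpM2r.
    have -> : CP * (C / n.+1%:R * `|ax|) = CP * `|ax| * C / n.+1%:R by ring.
    by rewrite ler_wpM2r// ?invr_ge0// AE lerDl.
  have Fxb : b <= `|F x|.
    have y0F : `|y0 - y0| < rF by rewrite subrr normr0.
    have := FL _ _ (or_intror Gy0) (or_introl Ox) y0F xF.
    have : CF * `|x - y0| <= b.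
      move: xb; rewrite ltr_pdivlMr// mulrC => /ltW; apply: le_trans.
      by rewrite ler_wpM2r// lerDl.
    have := ler_normB (F x) (F x - F y0); rewrite subKr /b; lra.
  split=> //; rewrite normrM normfV (gtr0_norm (Px Ox)).
  rewrite ler_pdivlMl ?Px//; apply: le_trans Fxb.
  apply: (@le_trans _ _ (A / n.+1%:R * (b / A * n.+1%:R))).
    by rewrite ler_wpM2r// mulr_ge0// divr_ge0// ltW.
  rewrite le_eqVlt; apply/orP; left; apply/eqP.
  by field; rewrite nat1r pnatr_eq0 (gt_eqF A0).
apply: (@vanishing_sets_not_L1_on _ _ _ _ E
  (fun n => b / A * n.+1%:R) (b / A * kappa)).
- exact: openI.
- exact: mE.
- by move=> n t /main[].
- move=> t; have [ht|ht] := leP (height Q k gam (row_of_tuple t)) 0.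
    by apply: nearW => n /EP[_]; rewrite ltNge ht.
  near=> n => /EP[_ _]; apply/negP; rewrite -ltNge ltr_pdivrMr// mulrC.
  rewrite -ltr_pdivrMr//.
  apply: (@lt_le_trans _ _ (Num.trunc (C / height Q k gam (row_of_tuple t))).+1%:R).
    exact: truncnS_gt.
  by rewrite ler_nat ltnS; near: n; exact: nbhs_infty_ge.
- by move=> n t /main[].
- by move=> n; rewrite mulr_ge0// divr_ge0// ltW.
- by rewrite mulr_gt0// divr_gt0.
- move=> n; rewrite muE -EFinM lee_fin.
  have -> : forall u : R, u * n.+1%:R * (kappa / n.+1%:R) = u * kappa.
    by move=> u; field; rewrite nat1r pnatr_eq0.
  exact: lexx.
Unshelve. all: by end_near. Qed.

Lemma dist_to_gt0 (R : realType) (d : nat) (Om A : set 'rV[R]_d)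
    (x : 'rV[R]_d) :
  open Om -> Om x -> A !=set0 -> (forall y, A y -> ~ Om y) ->
  0 < dist_to x A.
Proof.
move=> oOm Ox A0 AO.
have /nbhs_ballP[r /= r0 rO] : nbhs x Om by exact: open_nbhs_nbhs.
apply: (lt_le_trans r0); apply: dist_to_ge => // y Ay.
rewrite (le_trans _ (norm_le_enorm _))// leNgt; apply/negP => xy.
by apply: (AO _ Ay); apply: rO; rewrite ball_rV.
Qed.

(** * The normal component of the velocity *)

(** Think of w as the increment, along the displacement h, of a field whose
    components have the gradients b_j nu.  The linear part of w . nu is then
    (b . nu) (nu . h), and b . nu is the divergence of the field. *)
Lemma normal_component_le (R : realType) (d : nat) (b nu w h : 'rV[R]_d)
    (e : R) : edot b nu = 0 -> 0 <= e ->
  (forall j, `|w 0 j - b 0 j * edot nu h| <= e) ->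
  `|edot w nu| <= d%:R * `|nu| * e.
Proof.
move=> bnu e0 wb.
have -> : edot w nu = edot nu (w - edot nu h *: b).
  by rewrite edotBr edotZr [edot nu b]edotC bnu mulr0 subr0 edotC.
rewrite (le_trans (norm_edot_le _ _))// ler_wpM2l ?mulr_ge0//.
by apply: rV_norm_le => // j; rewrite !mxE mulrC.
Qed.

Theorem corollary6p5 (R : realType) (d : nat) (Om Gam : set 'rV[R]_d)
    (nu : 'rV[R]_d -> 'rV[R]_d) (I : set R)
    (p : 'rV[R]_d -> R -> R) (J : 'rV[R]_d -> R -> 'rV[R]_d)
    (c : R) (x0 : 'rV[R]_d) (t0 : R)
    (Om_bounded : bounded_set Om)
    (Om_Lipschitz : Lipschitz_domain Om)
    (Gam_patch : C11_patch Om Gam nu)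
    (I_interval : is_interval I)
    (I_nondegenerate : I° !=set0)
    (p_C1 : C1_upto Om Gam I p)
    (J_C1 : forall i : 'I_d, C1_upto Om Gam I (fun x t => J x t 0 i))
    (continuity_eq : set_nbhs Gam [set x | Om x ->
       forall t : R, I° t -> derive1 (p x) t + divergence (J ^~ t) x = 0])
    (J_no_flux : forall (x : 'rV[R]_d) (t : R), Gam x -> I t -> edot (J x t) (nu x) = 0)
    (p_vanishes : forall (x : 'rV[R]_d) (t : R), Gam x -> I t -> p x t = 0)
    (c_gt0 : 0 < c)
    (p_nondegenerate : set_nbhs Gam [set x | Om x ->
       forall t : R, I t -> c * dist_to x Gam <= p x t])
    (Gam_x0 : Gam x0) (I_t0 : I t0) :
  let v (x : 'rV[R]_d) (t : R) : 'rV[R]_d := (p x t)^-1 *: J x t in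
  ~ ((fun x => edot (v x t0) (nu x0)) @ within Om (nbhs x0) --> (0 : R)) ->
  forall N : set 'rV[R]_d, open N -> N x0 ->
    ~ vL1_on (Om `&` N) (v ^~ t0).
Proof.
move=> v not_cvg N oN Nx0 vL1; apply: not_cvg.
have [oOm _ lOm] := Om_Lipschitz.
have [[V oV GE] charts] := Gam_patch.
have GO : Gam `<=` topo_boundary Om by rewrite GE => y [].
have G_notin y : Gam y -> ~ Om y.
  by move=> /GO[_ nO] Oy; apply: nO; exact: open_nbhs_nbhs.
have G0 : Gam !=set0 by exists x0.
have dist_gt0 x : Om x -> 0 < dist_to x Gam.
  by move=> Ox; exact: dist_to_gt0 Ox G0 G_notin.
have p_ge y : Gam y -> \forall x \near y, Om x ->
    0 < p x t0 /\ c * dist_to x Gam <= p x t0.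
  move=> Gy; apply: filterS (p_nondegenerate y Gy) => x px Ox.
  have := px Ox t0 I_t0; split => //; apply: lt_le_trans (px Ox t0 I_t0).
  by rewrite mulr_gt0// dist_gt0.
have J0 j y : Gam y -> N y -> J y t0 0 j = 0.
  move=> Gy Ny; apply/eqP/negPn/negP => Jy.
  apply: (@quotient_not_L1_on R d Om Gam V N (fun x => J x t0 0 j) (p ^~ t0) y) => //.
  - exact: (C1_upto_lipschitz_near Om_Lipschitz GO I_interval I_nondegenerate (J_C1 j)).
  - exact: (C1_upto_lipschitz_near Om_Lipschitz GO I_interval I_nondegenerate p_C1).
  - by move=> z Gz; exact: p_vanishes.
  - by apply: filterS (p_ge y Gy) => x px /px[].
  - have [g ig gE] := vL1 j; exists g => //.
    by apply: filterS gE => t gE At; rewrite -gE// /v mxE.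
have N_x0 : nbhs x0 N by exact: open_nbhs_nbhs.
have [l lP] := choice (fun j => C1_upto_partials (J_C1 j) Gam_x0 I_t0).
have [W [Q [k [gam [ch lgam]]]]] := lOm _ (GO _ Gam_x0).
have strict j := C1_upto_strict oOm GO ch lgam I_interval I_nondegenerate
  (J_C1 j) Gam_x0 I_t0 (lP j).
(* a second chart: the Lipschitz one serves the estimates, and the C^{1,1} one
   gives the tangent vectors and nu *)
have [W' [Q' [k' [gam' [ch' [dgam' _] nuE]]]]] := charts _ Gam_x0.
have nu0E : nu x0 = chart_normal Q' k' gam' x0.
  by apply: nuE => //; case: ch'.
have grad j : exists b, l j = b *: nu x0.
  rewrite nu0E; apply: (gradient_normal (F := fun x => J x t0 0 j)
    oOm oV GE Gam_x0 ch' dgam').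
    move=> e e0; have [r r0 rP] := strict e j e0.
    apply/nbhs_ballP; exists r => // x; rewrite ball_rV/= distrC => xr Gx.
    by apply: rP => //; [right|right|rewrite subrr normr0].
  by apply: filterS N_x0 => x Nx Gx; exact: J0.
have [b bE] := choice grad.
have bnu : edot (\row_j b j) (nu x0) = 0.
  have clx : closure Om x0 by case: (GO _ Gam_x0).
  rewrite -[RHS](boundary_divergence0 clx I_interval I_nondegenerate p_C1
    p_vanishes (continuity_eq _ Gam_x0) Gam_x0 I_t0 (fun j i => lP j i)).
  by apply: eq_bigr => i _; rewrite bE !mxE.
pose S := d%:R * `|nu x0| + 1.
have S0 : 0 < S by rewrite ltr_wpDl// mulr_ge0.
apply/cvgrPdist_le => e e0.
pose e1 := e * c / S; have e10 : 0 < e1 by rewrite divr_gt0// mulr_gt0.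
have [r r0 rP] : exists2 r, 0 < r & forall j x y, (Om `|` Gam) x -> (Om `|` Gam) y ->
    `|x - x0| < r -> `|y - x0| < r ->
    `|J y t0 0 j - J x t0 0 j - edot (l j) (y - x)| <= e1 * `|y - x|.
  have rj j : exists rj : R, 0 < rj /\ forall x y, (Om `|` Gam) x -> (Om `|` Gam) y ->
      `|x - x0| < rj -> `|y - x0| < rj ->
      `|J y t0 0 j - J x t0 0 j - edot (l j) (y - x)| <= e1 * `|y - x|.
    by have [rj rj0 rjP] := strict e1 j e10; exists rj.
  have [rs rsP] := choice rj.
  exists (\big[Num.min/1]_(j < d) rs j).
    by apply/bigmin_gtP; split => // j _; case: (rsP j).
  move=> j x y Ax Ay xr yr; apply: (rsP j).2 => //.
    exact: (lt_le_trans xr (bigmin_le _ _ _)).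
  exact: (lt_le_trans yr (bigmin_le _ _ _)).
have /nbhs_ballP[r1 /= r10 r1N] := N_x0.
have r20 : 0 < Num.min r r1 by rewrite lt_min r0.
have d10 : 0 < d%:R + 1 :> R by rewrite ltr_wpDl.
have near_x0 : \forall x \near x0, (d%:R + 1) * `|x - x0| < Num.min r r1 / 2.
  apply/nbhs_ballP; exists (Num.min r r1 / 2 / (d%:R + 1)).
    by rewrite /= !divr_gt0.
  by move=> x; rewrite ball_rV/= distrC ltr_pdivlMr// mulrC.
have p_x0 := p_ge _ Gam_x0.
rewrite near_withinE; near=> x => Ox.
have xr : (d%:R + 1) * `|x - x0| < Num.min r r1 / 2 by near: x.
have [px0 pxc] : 0 < p x t0 /\ c * dist_to x Gam <= p x t0 by move: Ox; near: x.
have d0 := dist_gt0 _ Ox.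
have Jnu : `|edot (J x t0) (nu x0)| <= S * e1 * dist_to x Gam.
  apply/ler_addgt0Pr => eta eta0.
  pose eta' := Num.min (Num.min r r1 / 2) (eta / (S * e1)).
  have Se1 : 0 < S * e1 by rewrite mulr_gt0.
  have eta'0 : 0 < eta' by rewrite lt_min !divr_gt0.
  have [y Gy xy] := dist_to_approx x G0 eta'0.
  have xy' : `|x - y| < dist_to x Gam + eta'.
    exact: le_lt_trans (norm_le_enorm _) xy.
  have dx : dist_to x Gam <= d%:R * `|x - x0|.
    exact: le_trans (dist_to_le x Gam_x0) (enorm_le _).
  have [eta1 eta2] : eta' <= Num.min r r1 / 2 /\ eta' <= eta / (S * e1).
    by split; rewrite ge_min lexx ?orbT.
  have yr : `|y - x0| < Num.min r r1.
    have := ler_normD (y - x) (x - x0); rewrite subrKA [`|y - x|]distrC.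
    move: xr; rewrite mulrDl mul1r; lra.
  have [yr0 yr1] : `|y - x0| < r /\ `|y - x0| < r1.
    by move: yr; rewrite lt_min => /andP[].
  have xr0 : `|x - x0| < r.
    have : Num.min r r1 <= r by rewrite ge_min lexx.
    have : 0 <= d%:R * `|x - x0| by rewrite mulr_ge0.
    move: xr; rewrite mulrDl mul1r; lra.
  have Ny : N y by apply: r1N; rewrite ball_rV/= distrC.
  apply: (@le_trans _ _ (d%:R * `|nu x0| * (e1 * `|x - y|))).
    apply: (@normal_component_le _ _ (\row_j b j) _ _ (x - y)) => //.
      by rewrite mulr_ge0// ltW.
    move=> j; rewrite mxE.
    have := rP j y x (or_intror Gy) (or_introl Ox) yr0 xr0.
    rewrite (J0 j _ Gy Ny) subr0 bE; congr (is_true (`|_ - _| <= _)).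
    by rewrite edotC edotZr edotC.
  apply: (@le_trans _ _ (S * e1 * `|x - y|)).
    by rewrite -[leRHS]mulrA ler_wpM2r ?lerDl// mulr_ge0// ltW.
  apply: (@le_trans _ _ (S * e1 * (dist_to x Gam + eta'))).
    by rewrite ler_wpM2l// ltW.
  rewrite mulrDr lerD2l; move: eta2; rewrite ler_pdivlMr// mulrC //.
rewrite sub0r normrN /v edotC edotZr normrM normfV (gtr0_norm px0) edotC.
rewrite ler_pdivrMl//; apply: le_trans Jnu _.
have -> : S * e1 = e * c by rewrite /e1 mulrC divfK// gt_eqF.
by rewrite -mulrA [leRHS]mulrC ler_wpM2l// ltW.
Unshelve. all: by end_near. Qed.
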